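(* Let $K$ and $L$ be compact lines and $\phi:K\to L$ a continuous increasing surjection. If $L$ is separably determined and $\phi^{-1}(t)$ is separably determined for every $t\in L$, then $K$ is separably determined.
   Context: A compact line is a totally ordered set which is compact in its order topology; each $\phi^{-1}(t)$ is a closed interval of $K$, hence a compact line. For a compact line $H$, $H^+$ is the set of right-isolated points of $H$ ($\max H$ or points with an immediate successor in $H$). $\mathrm{NBV}(K)$ is the space of right-continuous real maps of bounded variation on $K$, identified with $C(K)^*$ via $F_\mu(t)=\mu([\min K,t])$. $\lim_{i\in I}a_i=0$ means $\{i:|a_i|\ge\varepsilon\}$ is finite for every $\varepsilon>0$; $c_0(I)$ is the set of such families. $(F_i)_{i\in I}$ is weak*-null if $\lim_i\int f\,d\mu_i=0$ for all $f\in C(K)$, $\mu_i$ associated with $F_i$. $(F_i)$ is of type $c_0\ell_1$ over $Q$ if $F_i(t)=a_{i,t}+b_{i,t}$ ($i\in I,t\in Q$) with $\lim_ia_{i,t}=0$ for each $t$ and $\sup_i\sum_{t\in Q}|b_{i,t}|<\infty$. A compact line $K$ is separably determined if for every weak*-null family $(F_i)_{i\in I}$ in $\mathrm{NBV}(K)$ and every $Q\subseteq K$: whenever $\{t\in Q\cap(H\setminus H^+):(F_i(t))_{i\in I}\notin c_0(I)\}$ is countable for every closed separable $H\subseteq K$, the family is of type $c_0\ell_1$ over $Q$. *)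

(* Defs.v *)
From HB Require Import structures.
From mathcomp Require Import all_boot all_order all_algebra.
From mathcomp Require Import boolp classical_sets cardinality reals.
Set Implicit Arguments. Unset Strict Implicit. Unset Printing Implicit Defensive.
Import Order.TTheory GRing.Theory Num.Theory.
Local Open Scope classical_set_scope.
Local Open Scope ring_scope.

(* Throughout, a totally ordered set is a subset X of a type T carrying a
   total order (orderType); X carries the induced order and its OWN order
   topology.  Taking X = [set: T] gives T itself; taking X = phi^-1(t) gives
   the fibre as a totally ordered set. *)

Section OrderTop.
Context {d : Order.disp_t} {T : orderType d}.

Definition lo_ok (X : set T) (lo : option T) (x : T) : Prop :=
  match lo with Some a => X a /\ (a < x)%O | None => True end.
Definition hi_ok (X : set T) (hi : option T) (x : T) : Prop :=
  match hi with Some b => X b /\ (x < b)%O | None => True end.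

Definition oopen (X A : set T) : Prop :=
  forall x, X x -> A x -> exists lo hi : option T,
    [/\ lo_ok X lo x, hi_ok X hi x &
        forall y, X y -> lo_ok X lo y -> hi_ok X hi y -> A y].

Definition oclosed (X H : set T) : Prop := H `<=` X /\ oopen X (X `\` H).

Definition ocompact (X : set T) : Prop :=
  forall (I : Type) (U : I -> set T), (forall i, oopen X (U i)) ->
    X `<=` \bigcup_i U i ->
    exists J : set I, finite_set J /\ X `<=` \bigcup_(i in J) U i.

Definition oclosure (X D : set T) : set T :=
  [set x | X x /\ forall U, oopen X U -> U x -> exists y, D y /\ U y].
Definition oseparable (X H : set T) : Prop :=
  exists D : set T, [/\ countable D, D `<=` H & H `<=` oclosure X D].

Definition rplus (H : set T) : set T :=
  [set t | H t /\ ((forall s, H s -> (s <= t)%O) \/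
     exists s, [/\ H s, (t < s)%O & forall r, H r -> (t < r)%O -> (s <= r)%O])].
End OrderTop.

Definition ocont {d1 d2 : Order.disp_t} {T1 : orderType d1} {T2 : orderType d2}
  (X : set T1) (Y : set T2) (f : T1 -> T2) : Prop :=
  forall B, oopen Y B -> oopen X (f @^-1` B).

Section NBV.
Context (R : realType) {d : Order.disp_t} {T : orderType d}.

Definition c0 {I : Type} (a : I -> R) : Prop :=
  forall eps : R, 0 < eps -> finite_set [set i | eps <= `|a i|].

Definition rightcont (X : set T) (F : T -> R) : Prop :=
  forall t, X t -> forall eps : R, 0 < eps ->
    (forall s, X s -> (s <= t)%O) \/
    exists u, [/\ X u, (t < u)%O &
       forall s, X s -> (t <= s)%O -> (s < u)%O -> `|F s - F t| < eps].

Definition chain_var (F : T -> R) (s : seq T) : R :=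
  match s with
  | [::] => 0
  | x :: s' => \sum_(v <- pairmap (fun a b => `|F b - F a|) x s') v
  end.

Definition bounded_var (X : set T) (F : T -> R) : Prop :=
  exists M : R, forall s : seq T, (forall x, x \in s -> X x) ->
    sorted (fun a b => (a < b)%O) s -> chain_var F s <= M.

Definition NBV (X : set T) (F : T -> R) : Prop := rightcont X F /\ bounded_var X F.

(* Stieltjes sum for the partition t_1 < ... < t_n (t_1 = min X eventually):
   f(t_1) F(t_1) + sum_k f(t_k) (F(t_k) - F(t_{k-1}));
   this is the sum of f(t_k) mu((t_{k-1}, t_k]) (+ f(t_1) mu({t_1})),
   mu being the measure with F(t) = mu([min X, t]). *)
Definition rs_sum (F f : T -> R) (s : seq T) : R :=
  match s with
  | [::] => 0
  | x :: s' => f x * F x + \sum_(v <- pairmap (fun a b => f b * (F b - F a)) x s') v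
  end.

Definition sorted_part (P : seq T) : seq T := sort (fun a b => (a <= b)%O) (undup P).

(* v = \int f d mu_F, as the limit over finite subsets P of X directed by
   inclusion of the Stieltjes sums *)
Definition stieltjes_int (X : set T) (F f : T -> R) (v : R) : Prop :=
  forall eps : R, 0 < eps -> exists P0 : seq T, (forall x, x \in P0 -> X x) /\
    forall P : seq T, {subset P0 <= P} -> (forall x, x \in P -> X x) ->
      `|rs_sum F f (sorted_part P) - v| < eps.

(* weak*-null family in NBV(X) = C(X)^* *)
Definition weakstar_null {I : Type} (X : set T) (F : I -> T -> R) : Prop :=
  forall f : T -> R, ocont X [set: R] f ->
    exists v : I -> R, (forall i, stieltjes_int X (F i) f (v i)) /\ c0 v.

Definition type_c0l1 {I : Type} (Q : set T) (F : I -> T -> R) : Prop :=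
  exists a b : I -> T -> R,
    [/\ forall i t, Q t -> F i t = a i t + b i t,
        forall t, Q t -> c0 (fun i => a i t) &
        exists M : R, forall i (s : seq T), uniq s -> (forall t, t \in s -> Q t) ->
          \sum_(t <- s) `|b i t| <= M].

Definition sep_determined (X : set T) : Prop :=
  forall (I : Type) (F : I -> T -> R), (forall i, NBV X (F i)) ->
    weakstar_null X F ->
    forall Q : set T, Q `<=` X ->
      (forall H : set T, oclosed X H -> oseparable X H ->
         countable [set t | [/\ Q t, H t, ~ rplus H t & ~ c0 (fun i => F i t)]]) ->
      type_c0l1 Q F.
End NBV.

(* Main.v *)
Require Import Defs.
From HB Require Import structures.
From mathcomp Require Import all_boot all_order all_algebra.
From mathcomp Require Import boolp classical_sets functions cardinality reals.
From mathcomp Require Import ring lra.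
Import Order.TTheory GRing.Theory Num.Theory.
Local Open Scope classical_set_scope.
Local Open Scope ring_scope.
Set Implicit Arguments. Unset Strict Implicit. Unset Printing Implicit Defensive.

(** The family (F_i) is uniformly bounded in variation (uniform boundedness principle), and a
    bounded weak*-null family satisfies sum_(t in E) |F_i(t)| <= M for all but finitely many i,
    for every finite set E of points: between two consecutive points of E, F_i must come close
    to 0.  Moreover F_i(s) <> 0 for only countably many i, whatever the point s.  Consequently, it is
    enough to write F = a + b over Q with a_{.,t} in c_0 and with each b_i countably supported:
    the graph joining i to the points t with b_i(t) <> 0 <> F_i(t) then has countable
    components, and the first bound, applied along an enumeration of each component,
    allows one to replace b by a family which is bounded in ell_1.  No uniformity over the
    fibres of phi is needed any more.  At the points max phi^-1(t), the decomposition comes from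
    the push-forward of F to L.  At the other points of phi^-1(t), F_i is equal to the integral of a fixed
    continuous function if it is constant on the fibre, and for each i this fails for only countably
    many t, for which one uses that the fibre is separably determined. *)

(** * Continuous functions and compactness *)

Section Continuity.
Context {R : realType} {d : Order.disp_t} {K : orderType d}.

Lemma ocont_realP (f : K -> R) : ocont [set: K] [set: R] f <->
  forall x (e : R), 0 < e -> exists lo hi : option K,
    [/\ lo_ok [set: K] lo x, hi_ok [set: K] hi x &
      forall y, lo_ok [set: K] lo y -> hi_ok [set: K] hi y -> `|f y - f x| < e].
Proof.
split=> [cf x e e0|cf B oB x _ Bfx].
  have /cf : oopen [set: R] [set z | `|z - f x| < e].
    move=> z _ ze; exists (Some (f x - e)), (Some (f x + e)).
    move: ze; rewrite /= ltr_norml => /andP[z1 z2].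
    split; [by split=> //; lra|by split=> //; lra|].
    by move=> y _ [_ ?] [_ ?]; rewrite /= ltr_norml; apply/andP; split; lra.
  move=> /(_ x I) [|lo [hi [lox hix h]]]; first by rewrite /= subrr normr0.
  by exists lo, hi; split=> // y ly hy; exact: (h y I).
have [lo [hi [lox hix h]]] := oB (f x) I Bfx.
have [e1 e10 he1] : exists2 e1, 0 < e1 & forall z, `|z - f x| < e1 -> lo_ok [set: R] lo z.
  case: lo lox {h} => [a [_ ax]|_]; last by exists 1.
  exists (f x - a); first by rewrite subr_gt0.
  by move=> z; rewrite ltr_norml => /andP[? ?]; split=> //; lra.
have [e2 e20 he2] : exists2 e2, 0 < e2 & forall z, `|z - f x| < e2 -> hi_ok [set: R] hi z.
  case: hi hix {h} => [a [_ ax]|_]; last by exists 1.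
  exists (a - f x); first by rewrite subr_gt0.
  by move=> z; rewrite ltr_norml => /andP[? ?]; split=> //; lra.
have [|l [u [lx ux hf]]] := cf x (Num.min e1 e2); first by rewrite lt_min e10.
exists l, u; split=> // y _ ly uy.
move: (hf y ly uy); rewrite lt_min => /andP[h1 h2].
by apply: h => //; [exact: he1|exact: he2].
Qed.

Definition lo_max (a b : option K) : option K :=
  match a, b with Some x, Some y => Some (Order.max x y) | Some x, None => Some x | None, _ => b end.
Definition hi_min (a b : option K) : option K :=
  match a, b with Some x, Some y => Some (Order.min x y) | Some x, None => Some x | None, _ => b end.

Lemma lo_maxP a b x :
  lo_ok [set: K] (lo_max a b) x <-> lo_ok [set: K] a x /\ lo_ok [set: K] b x.
Proof.
case: a b => [a|] [b|] /=; try by split=> // -[].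
by rewrite gt_max; split=> [[_ /andP[]]|[[_ ->] [_ ->]]].
Qed.

Lemma hi_minP a b x :
  hi_ok [set: K] (hi_min a b) x <-> hi_ok [set: K] a x /\ hi_ok [set: K] b x.
Proof.
case: a b => [a|] [b|] /=; try by split=> // -[].
by rewrite lt_min; split=> [[_ /andP[]]|[[_ ->] [_ ->]]].
Qed.

Lemma ocont_cst (c : R) : ocont [set: K] [set: R] (fun=> c).
Proof.
by apply/ocont_realP => x e e0; exists None, None; split=> // y _ _; rewrite subrr normr0.
Qed.

Lemma ocont_lin (f g : K -> R) (c : R) : ocont [set: K] [set: R] f ->
  ocont [set: K] [set: R] g -> ocont [set: K] [set: R] (fun x => f x + c * g x).
Proof.
move=> /ocont_realP cf /ocont_realP cg; apply/ocont_realP => x e e0.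
have c0 : 0 < `|c| + 1 by rewrite ltr_wpDl.
have [|lf [hf [lfx hfx ff]]] := cf x (e / 2); first by rewrite divr_gt0.
have [|lg [hg [lgx hgx gg]]] := cg x (e / 2 / (`|c| + 1)); first by rewrite !divr_gt0.
exists (lo_max lf lg), (hi_min hf hg); split; [exact/lo_maxP|exact/hi_minP|].
move=> y /lo_maxP [l1 l2] /hi_minP [h1 h2].
have -> : f y + c * g y - (f x + c * g x) = (f y - f x) + c * (g y - g x) by lra.
apply: le_lt_trans (ler_normD _ _) _; rewrite normrM.
have h3 := ff _ l1 h1; have := gg _ l2 h2; rewrite ltr_pdivlMr// => h4.
suff : `|c| * `|g y - g x| <= `|g y - g x| * (`|c| + 1) by lra.
by have := normr_ge0 (g y - g x); nra.
Qed.

Lemma ocont_uniform_limit (f : K -> R) (g : nat -> K -> R) :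
  (forall n, ocont [set: K] [set: R] (g n)) ->
  (forall e : R, 0 < e -> exists n, forall x, `|f x - g n x| <= e) ->
  ocont [set: K] [set: R] f.
Proof.
move=> cg fg; apply/ocont_realP => x e e0.
have [|n hn] := fg (e / 4); first by rewrite divr_gt0.
have /ocont_realP /(_ x (e / 4)) [|lo [hi [lox hix h]]] := cg n; first by rewrite divr_gt0.
exists lo, hi; split=> // y ly hy; have := h y ly hy; have := hn y; have := hn x.
by rewrite !ler_norml !ltr_norml; lra.
Qed.

End Continuity.

Section Complete.
Context {d : Order.disp_t} {K : orderType d}.
Hypothesis cK : ocompact [set: K].

(** Without a least upper bound, the rays below points of [A] and the rays above upper bounds of [A]
    cover [K]. The maximum of [a0] and of those indices of a finite subcover that lie in [A] is not
    covered. *)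
Lemma compact_lub (A : set K) : A !=set0 ->
  exists m, (forall a, A a -> (a <= m)%O) /\
    forall u, (forall a, A a -> (a <= u)%O) -> (m <= u)%O.
Proof.
move=> [a0 Aa0]; apply: contrapT => nlub.
pose ub u := forall a, A a -> (a <= u)%O.
pose U z := [set y | (A z /\ (y < z)%O) \/ (ub z /\ (z < y)%O)].
have [||J [fJ cJ]] := cK (U := U).
- move=> z y _ [[Az yz]|[uz zy]].
    by exists None, (Some z); split=> // w _ _ [_ ?]; left.
  by exists (Some z), None; split=> // w _ [_ ?] _; right.
- move=> y _; have [uy|nuy] := pselect (ub y); last first.
    have [a /not_implyP [Aa /negP]] : exists a, ~ (A a -> (a <= y)%O) by exact/existsNP.
    by rewrite -ltNge => ya; exists a => //; left.
  apply: contrapT => nU; apply: nlub; exists y; split=> // u uu.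
  by rewrite leNgt; apply/negP => uy'; apply: nU; exists u => //; right.
have [s sJ] := (finite_seqP _).1 fJ.
pose m := foldr (fun z m => if `[< A z >] then Order.max z m else m) a0 s.
have Am : A m.
  rewrite /m; elim: s {sJ m} => //= z s IH; case: asboolP => // Az.
  by rewrite /Order.max; case: ifP.
have mm : forall z, z \in s -> A z -> (z <= m)%O.
  rewrite /m; elim: s {sJ m Am} => //= z s IH w; rewrite inE => /orP[/eqP->|ws] Aw.
    by case: asboolP => // _; rewrite le_max lexx.
  by case: asboolP => // Az; rewrite ?le_max IH ?orbT.
have [z Jz [[Az mz]|[uz zm]]] := cJ m I.
  have zs : z \in s by move: Jz; rewrite sJ.
  by move: mz; rewrite ltNge mm.
by move: zm; rewrite ltNge uz.
Qed.

(** Apply [compact_lub] to the lower bounds. If there are none, the rays above points of [A] cover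
    [K], and the minimum of [a0] and of the indices of a finite subcover escapes it. *)
Lemma compact_glb (A : set K) : A !=set0 ->
  exists m, (forall a, A a -> (m <= a)%O) /\
    forall u, (forall a, A a -> (u <= a)%O) -> (u <= m)%O.
Proof.
move=> [a0 Aa0].
have [[l ll]|nl] := pselect (exists l, forall a, A a -> (l <= a)%O).
  have [|m [m1 m2]] := compact_lub (A := [set l | forall a, A a -> (l <= a)%O]).
    by exists l.
  by exists m; split=> // a Aa; apply: m2 => l' /(_ a Aa).
have [||J [fJ cJ]] := cK (U := fun a => [set y | A a /\ (a < y)%O]).
- by move=> a y _ [Aa ay]; exists (Some a), None; split=> // w _ [_ ?] _.
- move=> y _; apply: contrapT => nU; apply: nl; exists y => a Aa.
  by rewrite leNgt; apply/negP => ay; apply: nU; exists a.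
have [s sJ] := (finite_seqP _).1 fJ.
pose m := foldr Order.min a0 s.
have mm : forall z, z \in s -> (m <= z)%O.
  rewrite /m; elim: s {sJ m} => //= z s IH w; rewrite inE => /orP[/eqP->|/IH ws].
    by rewrite ge_min lexx.
  by rewrite ge_min ws orbT.
have [z Jz [Az zm]] := cJ m I.
have zs : z \in s by move: Jz; rewrite sJ.
by move: zm; rewrite ltNge mm.
Qed.

Lemma compact_max (x : K) : exists m : K, forall y : K, (y <= m)%O.
Proof.
have [|m [m1 _]] := compact_lub (A := [set: K]); first by exists x.
by exists m => y; exact: m1.
Qed.

End Complete.

Lemma half_expn_gt0 (R : realType) n : 0 < (2^-1 : R) ^+ n.
Proof. by rewrite exprn_gt0// invr_gt0. Qed.

Lemma half_expn_lt (R : realType) (e : R) : 0 < e -> exists n, (2^-1 : R) ^+ n < e.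
Proof.
move=> e0; exists (Num.bound e^-1).
have := @upper_nthrootP R e^-1 (Num.bound e^-1) (leqnn _).
by rewrite exprVn invf_plt ?posrE// exprn_gt0.
Qed.

Lemma le0_half_expn (R : realType) (t c : R) :
  0 <= c -> (forall n, t <= c * (2^-1 : R) ^+ n) -> t <= 0.
Proof.
move=> c0 tc; rewrite leNgt; apply/negP => t0.
have [|n] := @half_expn_lt R (t / (c + 1)); first by rewrite divr_gt0// ltr_wpDl.
rewrite ltr_pdivlMr ?ltr_wpDl// => h; have := tc n.
by have := half_expn_gt0 R n; lra.
Qed.

(** The intervals of centre [g n] and radius [r n] are nested; the supremum of their left ends
    belongs to all of them. *)
Lemma nested_limit (R : realType) (g r : nat -> R) : (forall n, 0 <= r n) ->
  (forall n, `|g n.+1 - g n| <= r n - r n.+1) -> exists l, forall n, `|l - g n| <= r n.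
Proof.
move=> r0 gr.
have lo m n : (m <= n)%N -> g m - r m <= g n - r n.
  elim: n => [|n IH]; first by rewrite leqn0 => /eqP ->.
  rewrite leq_eqVlt => /orP[/eqP ->//|/IH]; have := gr n; rewrite ler_norml; lra.
have up m n : (m <= n)%N -> g n + r n <= g m + r m.
  elim: n => [|n IH]; first by rewrite leqn0 => /eqP ->.
  rewrite leq_eqVlt => /orP[/eqP ->//|/IH]; have := gr n; rewrite ler_norml; lra.
have key m n : g m - r m <= g n + r n.
  have := lo _ _ (leq_maxl m n); have := up _ _ (leq_maxr m n).
  have := r0 (maxn m n); lra.
exists (sup (range (fun n => g n - r n))) => n.
rewrite ler_distl; apply/andP; split.
  apply: ub_le_sup; last by exists n.
  by exists (g 0%N + r 0%N) => _ [m _ <-].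
apply: ge_sup; first by exists (g 0%N - r 0%N), 0%N.
by move=> _ [m _ <-].
Qed.

(** * Decreasing Urysohn functions on a linear order *)

Section Urysohn.
Context {R : realType} {d : Order.disp_t} {K : orderType d}.

(** A continuous substitute for the indicator of the initial segment ending at [x]. Its integral
    against F lies between any two bounds for F on [x, y), hence is close to F(x) when F is
    right-continuous and [y] is near [x]. *)
Definition cut (x y : K) (f : K -> R) : Prop :=
  [/\ ocont [set: K] [set: R] f, forall u v, (u <= v)%O -> f v <= f u,
      forall z, (z <= x)%O -> f z = 1 & forall z, (y <= z)%O -> f z = 0].

Lemma cut_ge0 x y f z : cut x y f -> 0 <= f z.
Proof.
by move=> [_ hm _ h0]; rewrite -(h0 (Order.max z y)) ?le_max ?lexx ?orbT// hm// le_max lexx.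
Qed.

Lemma cut_le1 x y f z : cut x y f -> f z <= 1.
Proof.
by move=> [_ hm h1 _]; rewrite -(h1 (Order.min z x)) ?ge_min ?lexx ?orbT// hm// ge_min lexx.
Qed.

Section Bisection.
Variable mid : K -> K -> K.

(** Step functions decreasing from 1 - 2^-n to 0 between [a] and [b]; in the absence of gaps their
    uniform limit is the function wanted in [exists_cut]. *)
Fixpoint bisect (n : nat) (a b z : K) : R :=
  if n is n'.+1 then
    if (z < mid a b)%O then 2^-1 + 2^-1 * bisect n' a (mid a b) z
    else 2^-1 * bisect n' (mid a b) b z
  else 0.

Variables x y : K.
Hypothesis midP : forall u v, (x <= u)%O -> (u < v)%O -> (v <= y)%O ->
  (u < mid u v)%O /\ (mid u v < v)%O.

Lemma mid_sub a b : (x <= a)%O -> (a < b)%O -> (b <= y)%O ->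
  [/\ (a < mid a b)%O, (mid a b < b)%O, (x <= mid a b)%O & (mid a b <= y)%O].
Proof.
move=> xa ab yb; have [am mb] := midP xa ab yb; split=> //.
  exact: le_trans xa (ltW am).
exact: le_trans (ltW mb) yb.
Qed.

Lemma bisect_bounds n a b z : 0 <= bisect n a b z <= 1 - 2^-1 ^+ n.
Proof.
elim: n a b => [|n IH] a b /=; first by rewrite expr0 subrr lexx.
rewrite exprS; case: ifP => _.
  by have := IH a (mid a b); lra.
by have := IH (mid a b) b; have := half_expn_gt0 R n; lra.
Qed.

Lemma bisect_homo n a b u v : (u <= v)%O -> bisect n a b v <= bisect n a b u.
Proof.
move=> uv; elim: n a b => [|n IH] a b //=.
case: ifPn => vm; first by rewrite (le_lt_trans uv vm); have := IH a (mid a b); lra.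
case: ifPn => um; last by have := IH (mid a b) b; lra.
have := bisect_bounds n (mid a b) b v; have := bisect_bounds n a (mid a b) u.
by have := half_expn_gt0 R n; lra.
Qed.

Lemma bisect_step n a b z : `|bisect n.+1 a b z - bisect n a b z| <= 2^-1 ^+ n.+1.
Proof.
elim: n a b => [|n IH] a b.
  by rewrite /= expr1; case: ifP => _; rewrite ler_norml; lra.
have E m : bisect m.+1 a b z = if (z < mid a b)%O then
  2^-1 + 2^-1 * bisect m a (mid a b) z else 2^-1 * bisect m (mid a b) b z by [].
rewrite !E [(_ : R) ^+ n.+2]exprS; case: ifP => _.
  by have := IH a (mid a b); rewrite !ler_norml; lra.
by have := IH (mid a b) b; rewrite !ler_norml; lra.
Qed.

Lemma bisect_left n a b z : (x <= a)%O -> (a < b)%O -> (b <= y)%O ->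
  (z <= a)%O -> bisect n a b z = 1 - 2^-1 ^+ n.
Proof.
move=> + + + za; elim: n b => [|n IH] b xa ab yb /=; first by rewrite expr0 subrr.
have [am mb xm my] := mid_sub xa ab yb.
by rewrite (le_lt_trans za am) IH// exprS; lra.
Qed.

(** Vanishing already a little to the left of [b] is what makes the two halves match near a midpoint
    in [bisect_near]. *)
Lemma bisect_right n a b : (x <= a)%O -> (a < b)%O -> (b <= y)%O ->
  exists2 c, (c < b)%O & forall z, (c <= z)%O -> bisect n a b z = 0.
Proof.
elim: n a => [|n IH] a xa ab yb; first by exists a.
have [am mb xm my] := mid_sub xa ab yb.
have [c cb hc] := IH _ xm mb yb; exists (Order.max c (mid a b)); first by rewrite gt_max cb.
by move=> z; rewrite ge_max => /andP[cz mz] /=; rewrite ltNge mz /= hc// mulr0.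
Qed.

Lemma bisect_near n a b z : (x <= a)%O -> (a < b)%O -> (b <= y)%O ->
  exists lo hi : option K, [/\ lo_ok [set: K] lo z, hi_ok [set: K] hi z &
   forall w, lo_ok [set: K] lo w -> hi_ok [set: K] hi w ->
     `|bisect n a b w - bisect n a b z| <= 2^-1 ^+ n].
Proof.
elim: n a b => [|n IH] a b xa ab yb.
  by exists None, None; split=> // w _ _ /=; rewrite subrr normr0 expr0 ler01.
have [am mb xm my] := mid_sub xa ab yb.
have e0 := half_expn_gt0 R n.
have [zm|mz|zm] := ltgtP z (mid a b).
- have [lo [hi [loz hiz h]]] := IH _ _ xa am my.
  exists lo, (hi_min hi (Some (mid a b))); split=> //; first exact/hi_minP.
  move=> w lw /hi_minP[hw [_ wm]]; have := h w lw hw.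
  by rewrite /= wm zm exprS !ler_norml; lra.
- have [lo [hi [loz hiz h]]] := IH _ _ xm mb yb.
  exists (lo_max lo (Some (mid a b))), hi; split=> //; first exact/lo_maxP.
  move=> w /lo_maxP[lw [_ wm]] hw; have := h w lw hw.
  by rewrite /= ltNge (ltW wm) (ltNge z) (ltW mz) /= exprS !ler_norml; lra.
(* At the midpoint the value is (1 - 2^-n)/2, and just to its left it is 1/2: the jump is
   2^-(n+1). *)
have [lo [hi [loz hiz h]]] := IH _ _ xm mb yb.
have [c cm hc] := bisect_right n xa am my.
exists (Some c), hi; split=> //; first by rewrite /= zm.
move=> w [_ cw] hw; rewrite /= zm ltxx exprS (bisect_left n xm mb yb (lexx _)).
case: ifPn => wm; first by rewrite (hc _ (ltW cw)) ler_norml; lra.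
have lw : lo_ok [set: K] lo w.
  case: lo loz {h} => //= u [_ uz]; split=> //; apply: lt_le_trans uz _.
  by rewrite zm leNgt.
by have := h w lw hw; rewrite zm (bisect_left n xm mb yb (lexx _)) !ler_norml; lra.
Qed.

End Bisection.

(** If two points between [x] and [y] are neighbours, a step function jumping there is continuous.
    Otherwise midpoints always exist, and bisection converges uniformly with error 2^-n. *)
Lemma exists_cut (x y : K) : (x < y)%O -> exists f, cut x y f.
Proof.
move=> xy.
have [[u [v [xu uv vy gap]]]|nogap] := pselect (exists u v, [/\ (x <= u)%O, (u < v)%O,
    (v <= y)%O & forall w, ~ ((u < w)%O /\ (w < v)%O)]).
  exists (fun z => if (z <= u)%O then 1 else 0); split.
  - apply/ocont_realP => z e e0; case: ifPn => zu.
      exists None, (Some v); split=> //; first by split=> //; exact: le_lt_trans zu uv.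
      move=> w _ [_ wv]; case: ifPn; first by rewrite subrr normr0.
      by rewrite -ltNge => uw; case: (gap w).
    move: zu; rewrite -ltNge => uz; exists (Some u), None; split=> // w [_ uw] _.
    by rewrite leNgt uw /= subrr normr0.
  - move=> w z wz; case: ifPn => zu; first by rewrite (le_trans wz zu).
    by case: ifP => _; rewrite ?ler01.
  - by move=> z zx; rewrite (le_trans zx xu).
  - by move=> z yz; rewrite leNgt (lt_le_trans uv (le_trans vy yz)).
have [mid midP] : exists mid : K -> K -> K, forall u v, (x <= u)%O -> (u < v)%O -> (v <= y)%O ->
    (u < mid u v)%O /\ (mid u v < v)%O.
  have h (p : K * K) : exists m, (x <= p.1)%O -> (p.1 < p.2)%O -> (p.2 <= y)%O ->
      (p.1 < m)%O /\ (m < p.2)%O.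
    apply: contrapT => nm; apply: nogap; exists p.1, p.2.
    have /not_implyP[h1 /not_implyP[h2 /not_implyP[h3 _]]] :
      ~ ((x <= p.1)%O -> (p.1 < p.2)%O -> (p.2 <= y)%O -> False).
      by move=> h; apply: nm; exists x => h1 h2 h3; case: (h h1 h2 h3).
    by split=> // w wp; apply: nm; exists w.
  have [m hm] := choice h.
  by exists (fun u v => m (u, v)) => u v; exact: (hm (u, v)).
have lim z : exists l, forall n, `|l - bisect mid n x y z| <= (2^-1 : R) ^+ n.
  apply: nested_limit => n; first exact/ltW/half_expn_gt0.
  by apply: le_trans (bisect_step _ _ _ _ _) _; rewrite exprS; lra.
have [f hf] := choice lim.
exists f; split.
- apply/ocont_realP => z e e0.
  have [|n hn] := @half_expn_lt R (e / 3); first by rewrite divr_gt0.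
  have [lo [hi [loz hiz h]]] := bisect_near midP n z (lexx x) xy (lexx y).
  exists lo, hi; split=> // w lw hw; have := h w lw hw.
  have := hf z n; have := hf w n; rewrite !ler_norml ltr_norml; lra.
- move=> u v uv; rewrite -subr_le0.
  apply: (@le0_half_expn R _ 2) => // n.
  have := bisect_homo mid n x y uv; have := hf u n; have := hf v n.
  by rewrite !ler_norml; lra.
- move=> z zx; have h n : `|f z - 1| <= 2 * (2^-1 : R) ^+ n.
    have := hf z n; rewrite (bisect_left midP n (lexx x) xy (lexx y) zx) !ler_norml.
    have := half_expn_gt0 R n; lra.
  by apply/eqP; rewrite -subr_eq0 -normr_le0; exact: le0_half_expn h.
- move=> z yz; have h n : `|f z| <= 1 * (2^-1 : R) ^+ n.
    have [c cy hc] := bisect_right midP n (lexx x) xy (lexx y).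
    by have := hf z n; rewrite hc ?subr0 ?mul1r// (le_trans (ltW cy)).
  by apply/eqP; rewrite -normr_le0; exact: le0_half_expn h.
Qed.

End Urysohn.

(** * Stieltjes integrals *)

Section RiemannSums.
Context {R : realType} {d : Order.disp_t} {T : orderType d}.
Implicit Types (F f g : T -> R) (s : seq T).

Lemma sorted_part_lt s : sorted <%O (sorted_part s).
Proof. by rewrite lt_sorted_uniq_le sort_uniq undup_uniq sort_le_sorted. Qed.

Lemma mem_sorted_part s : sorted_part s =i s.
Proof. by move=> x; rewrite mem_sort mem_undup. Qed.

Lemma sorted_part_id s : sorted <%O s -> sorted_part s = s.
Proof.
move=> ss; apply: (lt_sorted_eq (sorted_part_lt s) ss).
exact: mem_sorted_part.
Qed.

Lemma stieltjes_intP (X : set T) F f (v : R) : stieltjes_int X F f v <->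
  forall e : R, 0 < e -> exists P0 : seq T, (forall x, x \in P0 -> X x) /\
    forall s, sorted <%O s -> {subset P0 <= s} -> (forall x, x \in s -> X x) ->
      `|rs_sum F f s - v| < e.
Proof.
split=> h e /h [P0 [P0X hP]]; exists P0; split=> // s.
  by move=> ss P0s sX; rewrite -(sorted_part_id ss); exact: hP.
move=> P0s sX; apply: hP; first exact: sorted_part_lt.
  by move=> x /P0s; rewrite mem_sorted_part.
by move=> x; rewrite mem_sorted_part => /sX.
Qed.

(* Abel summation, one step at a time *)
Lemma rs_sum_cons2 F f p q s :
  rs_sum F f [:: p, q & s] = (f p - f q) * F p + rs_sum F f (q :: s).
Proof. by rewrite /= big_cons; lra. Qed.

Lemma rs_sum1 F f p : rs_sum F f [:: p] = f p * F p.
Proof. by rewrite /= big_nil addr0. Qed.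

Lemma rs_sum_lin F f g (c : R) s :
  rs_sum F (fun x => f x + c * g x) s = rs_sum F f s + c * rs_sum F g s.
Proof.
elim: s => [|p [|q s] IH]; first by rewrite /= mulr0 addr0.
  by rewrite !rs_sum1; lra.
by rewrite !rs_sum_cons2 IH; lra.
Qed.

Lemma rs_sum_opp F f s : rs_sum (fun x => - F x) f s = - rs_sum F f s.
Proof.
elim: s => [|p [|q s] IH]; first by rewrite /= oppr0.
  by rewrite !rs_sum1; lra.
by rewrite !rs_sum_cons2 IH; lra.
Qed.

Lemma rs_sum_subc F f c p s :
  rs_sum (fun x => F x - c) f (p :: s) = rs_sum F f (p :: s) - c * f p.
Proof.
elim: s p => [|q s IH] p; first by rewrite !rs_sum1; lra.
by rewrite !rs_sum_cons2 IH; lra.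
Qed.

Lemma rs_sum_cst F c p s : rs_sum F (fun=> c) (p :: s) = c * F (last p s).
Proof.
elim: s p => [|q s IH] p; first by rewrite rs_sum1.
by rewrite rs_sum_cons2 IH /=; lra.
Qed.

Lemma chain_var_cons2 F p q s :
  chain_var F [:: p, q & s] = `|F q - F p| + chain_var F (q :: s).
Proof. by rewrite /= big_cons. Qed.

Lemma chain_var1 F p : chain_var F [:: p] = 0.
Proof. by rewrite /= big_nil. Qed.

Lemma rs_sum_bound F f c p s : (forall x, `|f x| <= c) ->
  `|rs_sum F f (p :: s)| <= c * (`|F p| + chain_var F (p :: s)).
Proof.
move=> fc; rewrite /= [c * _]mulrDr; apply: le_trans (ler_normD _ _) _.
apply: lerD; first by rewrite normrM ler_wpM2r.
elim: s p => [|q s IH] p; first by rewrite /= !big_nil normr0 mulr0.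
rewrite /= !big_cons [c * _]mulrDr; apply: le_trans (ler_normD _ _) _.
by apply: lerD; [rewrite normrM ler_wpM2r|exact: IH].
Qed.

(** Abel summation gives terms (f p - f q) F(p) with f p >= f q, and a last term where [f] is 0.
    They vanish for p >= y, and also for p < x, because [x] is a partition point and so f q = 1. The
    final alternative records whether [x] is still to come. *)
Lemma rs_sum_cut_le0 F x y f p s : cut x y f ->
  (forall u, (x <= u)%O -> (u < y)%O -> F u <= 0) ->
  sorted <%O (p :: s) -> (y <= last p s)%O -> x \in p :: s \/ (x <= p)%O ->
  rs_sum F f (p :: s) <= 0.
Proof.
move=> [_ hm h1 h0] Fle; elim: s p => [|q s IH] p /=.
  by move=> _ yp _; rewrite -[leLHS]/(rs_sum F f [:: p]) rs_sum1 h0// mul0r.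
move=> /andP[pq qs] yl xin.
have qx : (p < x)%O -> x \in q :: s.
  by move=> px; case: xin; rewrite ?leNgt ?px// inE => /orP[/eqP xp|//]; rewrite xp ltxx in px.
have {}IH : rs_sum F f (q :: s) <= 0.
  apply: IH => //; have [xp|/qx] := leP x p; last by left.
  by right; exact: le_trans xp (ltW pq).
rewrite -[leLHS]/(rs_sum F f [:: p, q & s]) rs_sum_cons2.
suff : (f p - f q) * F p <= 0 by lra.
have [yp|py] := leP y p; first by rewrite !h0 ?subr0 ?mul0r// (le_trans yp (ltW pq)).
have [xp|px] := leP x p.
  by apply: mulr_ge0_le0; [rewrite subr_ge0 hm// ltW|exact: Fle].
rewrite !h1 ?subrr ?mul0r ?(ltW px)//.
have := qx px; rewrite inE => /orP[/eqP ->//|xs].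
by apply: ltW; move: qs; rewrite lt_path_sortedE => /andP[/allP /(_ _ xs)].
Qed.

Lemma le_last s p x : sorted <%O (p :: s) -> x \in p :: s -> (x <= last p s)%O.
Proof.
elim: s p x => [|q s IH] p x /=; first by rewrite inE => _ /eqP ->.
move=> /andP[pq qs]; rewrite inE => /orP[/eqP ->|]; last by move=> h; apply: IH qs h.
by apply: le_trans (ltW pq) _; apply: IH => //; rewrite inE eqxx.
Qed.

Lemma head_le s p x : sorted <%O (p :: s) -> x \in p :: s -> (p <= x)%O.
Proof.
move=> /= ps; rewrite inE => /orP[/eqP ->//|xs].
by apply: ltW; move: ps; rewrite lt_path_sortedE => /andP[/allP /(_ _ xs)].
Qed.

Lemma rs_sum_cut_le F x y f c s : cut x y f -> sorted <%O s -> x \in s -> y \in s ->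
  (forall u, (x <= u)%O -> (u < y)%O -> F u <= c) -> rs_sum F f s <= c.
Proof.
case: s => [//|p s] cf ss xs ys Fc.
have fp : f p = 1 by have [_ _ -> //] := cf; exact: head_le ss xs.
(* As f p = 1, replacing [F] by F - c lowers the sum by exactly [c]. *)
rewrite -subr_le0 -[X in _ - X]mulr1 -fp -rs_sum_subc.
apply: (rs_sum_cut_le0 cf) => //; last by left.
- by move=> u xu uy; rewrite subr_le0 Fc.
- exact: le_last.
Qed.

Lemma chain_var_total (X : set T) F : bounded_var X F ->
  exists V, 0 <= V /\ forall p s, (forall x, x \in p :: s -> X x) -> sorted <%O (p :: s) ->
    `|F p| + chain_var F (p :: s) <= V.
Proof.
move=> [M hM].
have [[x0 Xx0]|nX] := pselect (exists x, X x); last first.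
  by exists 0; split=> // p s sX; case: nX; exists p; apply: sX; rewrite inE eqxx.
have M0 : 0 <= M by have := hM [::]; rewrite /=; apply.
exists (`|F x0| + 2 * M); split; first by rewrite addr_ge0// mulr_ge0.
move=> p s sX ss; have := hM _ sX ss.
suff : `|F p - F x0| <= M.
  by have := ler_normD (F p - F x0) (F x0); rewrite subrK; lra.
have Xp : X p by apply: sX; rewrite inE eqxx.
have h a b : X a -> X b -> (a < b)%O -> `|F b - F a| <= M.
  move=> Xa Xb ab; have := hM [:: a; b]; rewrite chain_var_cons2 chain_var1 addr0; apply.
    by move=> x; rewrite !inE => /orP[] /eqP ->.
  by rewrite /= ab.
have [px|xp|->] := ltgtP p x0; last by rewrite subrr normr0.
  by rewrite distrC h.
exact: h.
Qed.

End RiemannSums.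

Section Integral.
Context {R : realType} {d : Order.disp_t} {T : orderType d}.
Implicit Types (F f g : T -> R) (s : seq T).
Local Notation integral := (stieltjes_int [set: T]).

Lemma integral_approx F f (v : R) (P : seq T) (e : R) : integral F f v -> 0 < e ->
  exists s, [/\ sorted <%O s, {subset P <= s} & `|rs_sum F f s - v| < e].
Proof.
move=> /stieltjes_intP h /h [P0 [_ hP]]; exists (sorted_part (P0 ++ P)).
split; first exact: sorted_part_lt.
  by move=> x xP; rewrite mem_sorted_part mem_cat xP orbT.
apply: hP => //; first exact: sorted_part_lt.
by move=> x xP; rewrite mem_sorted_part mem_cat xP.
Qed.

Lemma integral_le F f (v c : R) (P : seq T) : integral F f v ->
  (forall s, sorted <%O s -> {subset P <= s} -> rs_sum F f s <= c) -> v <= c.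
Proof.
move=> Fv h; apply/ler_addgt0Pl => e e0.
have [s [ss Ps]] := integral_approx P Fv e0; rewrite ltr_norml.
by have := h s ss Ps; lra.
Qed.

Lemma integral_opp F f (v : R) : integral F f v -> integral (fun x => - F x) f (- v).
Proof.
move=> /stieltjes_intP h; apply/stieltjes_intP => e /h [P0 [PX hP]]; exists P0; split=> // s ss Ps sX.
by rewrite rs_sum_opp -opprD normrN; exact: hP.
Qed.

Lemma integral_unique F f (v w : R) : integral F f v -> integral F f w -> v = w.
Proof.
move=> fv fw; apply/eqP; rewrite -subr_eq0 -normr_le0; apply/ler_addgt0Pl => e e0.
have e2 : 0 < e / 2 by rewrite divr_gt0.
have /stieltjes_intP /(_ _ e2) [P0 [_ hP]] := fw.
have [s [ss Ps]] := integral_approx P0 fv e2.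
by have := hP s ss Ps (fun x _ => I); rewrite !ltr_norml ler_norml; lra.
Qed.

Lemma integral_lin F f g (v w c : R) : integral F f v -> integral F g w ->
  integral F (fun x => f x + c * g x) (v + c * w).
Proof.
move=> /stieltjes_intP hf /stieltjes_intP hg; apply/stieltjes_intP => e e0.
have c0 : 0 < `|c| + 1 by rewrite ltr_wpDl.
have [|Pf [_ hPf]] := hf (e / 2); first by rewrite divr_gt0.
have [|Pg [_ hPg]] := hg (e / 2 / (`|c| + 1)); first by rewrite !divr_gt0.
exists (Pf ++ Pg); split=> // s ss Ps sX; rewrite rs_sum_lin.
have -> (a b : R) : a + c * b - (v + c * w) = (a - v) + c * (b - w) by lra.
apply: le_lt_trans (ler_normD _ _) _; rewrite normrM.
have sf : {subset Pf <= s} by move=> x xP; apply: Ps; rewrite mem_cat xP.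
have sg : {subset Pg <= s} by move=> x xP; apply: Ps; rewrite mem_cat xP orbT.
have h1 := hPf s ss sf sX; have := hPg s ss sg sX; rewrite ltr_pdivlMr// => h2.
suff : `|c| * `|rs_sum F g s - w| <= `|rs_sum F g s - w| * (`|c| + 1) by lra.
by have := normr_ge0 (rs_sum F g s - w); nra.
Qed.

Lemma integral_cut_le F f x y (v c : R) : integral F f v -> cut x y f ->
  (forall u, (x <= u)%O -> (u < y)%O -> F u <= c) -> v <= c.
Proof.
move=> Fv cf Fc; apply: (integral_le (P := [:: x; y]) Fv) => s ss Ps.
by apply: rs_sum_cut_le cf ss _ _ Fc; apply: Ps; rewrite !inE eqxx ?orbT.
Qed.

Lemma integral_cut_ge F f x y (v c : R) : integral F f v -> cut x y f ->
  (forall u, (x <= u)%O -> (u < y)%O -> c <= F u) -> c <= v.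
Proof.
move=> /integral_opp Fv cf Fc; rewrite -lerN2; apply: integral_cut_le Fv cf _ => u xu uy.
by rewrite lerN2 Fc.
Qed.

Lemma integral_cut_near F f x y (v e : R) : integral F f v -> cut x y f -> 
  (forall u, (x <= u)%O -> (u < y)%O -> `|F u - F x| <= e) -> `|v - F x| <= e.
Proof.
move=> Fv cf h; rewrite ler_distl; apply/andP; split.
  apply: integral_cut_ge Fv cf _ => u xu uy.
  by have := h u xu uy; rewrite ler_norml; lra.
apply: integral_cut_le Fv cf _ => u xu uy.
by have := h u xu uy; rewrite ler_norml; lra.
Qed.

(** Otherwise F would keep the sign of F(x) on [x, y) with absolute value above |v| + e, and the
    integral would exceed |v| in absolute value. *)
Lemma integral_cut_jump F f x y (v e : R) : integral F f v -> cut x y f -> 0 < e ->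
  exists u, [/\ (x <= u)%O, (u < y)%O & `|F x| <= `|v| + e + `|F u - F x|].
Proof.
move=> Fv cf e0; apply: contrapT => nu.
have h u : (x <= u)%O -> (u < y)%O -> `|v| + e + `|F u - F x| < `|F x|.
  by move=> xu uy; rewrite ltNge; apply/negP => le; apply: nu; exists u.
have [Fx|Fx] := leP 0 (F x).
  suff : `|v| + e <= v by have := ler_norm v; lra.
  apply: integral_cut_ge Fv cf _ => u xu uy; have := h u xu uy.
  by rewrite (ger0_norm Fx); have := ler_norm (F x - F u); rewrite distrC; lra.
suff : v <= - (`|v| + e) by have := ler_norm (- v); rewrite normrN; lra.
apply: integral_cut_le Fv cf _ => u xu uy; have := h u xu uy.
by rewrite (ltr0_norm Fx); have := ler_norm (F u - F x); lra.
Qed.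

Lemma integral_cst F (v c : R) m : (forall y : T, (y <= m)%O) -> integral F (fun=> c) v ->
  v = c * F m.
Proof.
move=> mm Fv; apply: (integral_unique Fv); apply/stieltjes_intP => e e0; exists [:: m].
split=> // -[|p s] ss ms _; first by have := ms m; rewrite inE eqxx => /(_ isT).
rewrite rs_sum_cst; suff -> : last p s = m by rewrite subrr normr0.
by apply/le_anti; rewrite mm le_last// ms// inE.
Qed.

Lemma integral_bound (F : T -> R) : bounded_var [set: T] F -> exists V, 0 <= V /\
  forall f c v, 0 <= c -> (forall x, `|f x| <= c) -> integral F f v -> `|v| <= V * c.
Proof.
move=> /chain_var_total [V [V0 hV]]; exists V; split=> // f c v c0 fc Fv.
apply/ler_addgt0Pl => e e0.
have [[|p s] [ss _ hs]] := integral_approx [::] Fv e0.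
  move: hs; rewrite /= sub0r normrN => hs; apply: le_trans (ltW hs) _; rewrite lerDl.
  exact: mulr_ge0.
have h1 := rs_sum_bound F p s fc; have h2 := hV p s (fun _ _ => I) ss.
have h3 := ler_wpM2l c0 h2.
have := ler_normB (rs_sum F f (p :: s)) (rs_sum F f (p :: s) - v).
by rewrite subKr; lra.
Qed.

End Integral.

(** * Weak*-null families *)

Section CZero.
Context {R : realType} {I : Type}.
Implicit Types a b : I -> R.

Lemma c0_bounded a : c0 a -> exists B, forall i, `|a i| <= B.
Proof.
move=> /(_ 1 ltr01) fin.
have /finite_seqP [s hs] : finite_set ((fun i => `|a i|) @` [set i | 1 <= `|a i|]).
  exact: finite_image.
exists (1 + \sum_(x <- s) `|x|) => i.
have s0 (r : seq R) : 0 <= \sum_(x <- r) `|x| by exact: sumr_ge0.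
have [ai|ai] := leP 1 `|a i|; last by have := s0 s; lra.
have ais : `|a i| \in s.
  by have /(congr1 (fun A => A `|a i|)) /= <- := hs; exists i.
by rewrite (big_rem _ ais) /= normr_id; have := s0 (rem `|a i| s); lra.
Qed.

Lemma countable_lt_inv (A : set I) (h : I -> R) : 
  (forall i, A i -> 0 < h i) ->
  (forall e, 0 < e -> countable [set i | A i /\ e <= h i]) -> countable A.
Proof.
move=> hpos hc.
apply: (@sub_countable _ _ _ (\bigcup_n [set i | A i /\ (2^-1 : R) ^+ n <= h i])).
  apply: subset_card_le => i Ai; have [n hn] := half_expn_lt (hpos i Ai).
  by exists n => //; split=> //; exact: ltW.
apply: bigcup_countable => // n _; exact/hc/half_expn_gt0.
Qed.

Lemma c0_countable a : c0 a -> countable [set i | a i != 0].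
Proof.
move=> ca; apply: (@countable_lt_inv _ (fun i => `|a i|)).
  by move=> i /=; rewrite normr_gt0.
move=> e e0; apply: finite_set_countable; apply: sub_finite_set (ca e e0).
by move=> i [].
Qed.

Lemma c0_sub a (A : set I) (b : I -> R) : finite_set A -> c0 b ->
  (forall i, ~ A i -> `|a i| <= `|b i|) -> c0 a.
Proof.
move=> fA cb h e e0; apply: (@sub_finite_set _ _ (A `|` [set i | e <= `|b i|])).
  move=> i /= ei; have [Ai|nAi] := pselect (A i); first by left.
  by right; apply: le_trans ei (h i nAi).
by rewrite finite_setU; split=> //; exact: cb.
Qed.

End CZero.

(** * Uniform boundedness of the integrals *)

Section UniformBoundedness.
Context {R : realType} {d : Order.disp_t} {K : orderType d} {I : Type}.
Variables (F : I -> K -> R) (T : (K -> R) -> I -> R).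
Local Notation cts := (ocont [set: K] [set: R]).
Hypothesis bvF : forall i, bounded_var [set: K] (F i).
Hypothesis TP : forall f, cts f -> (forall i, stieltjes_int [set: K] (F i) f (T f i)) /\ c0 (T f).

Lemma T_lin f g c i : cts f -> cts g -> T (fun x => f x + c * g x) i = T f i + c * T g i.
Proof.
move=> cf cg; have [h _] := TP (ocont_lin (c:=c) cf cg); apply: integral_unique (h i) _.
by apply: integral_lin; [exact: (TP cf).1|exact: (TP cg).1].
Qed.

Lemma T_scale f c i : cts f -> T (fun x => c * f x) i = c * T f i.
Proof.
move=> cf; have c0f : cts (fun=> 0 : R) by exact: ocont_cst.
have -> : (fun x => c * f x) = (fun x => 0 + c * f x) by apply/funext => x; rewrite add0r.
rewrite T_lin//; suff -> : T (fun=> 0) i = 0 by rewrite add0r.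
have := T_lin 1 i c0f c0f.
by under eq_fun do rewrite mulr0 addr0; lra.
Qed.

(* Sokal's gliding hump: add 3^-n y_n with the sign that keeps T large *)
Lemma uniform_boundedness : exists M : R, forall i f, cts f -> (forall x, `|f x| <= 1) -> `|T f i| <= M.
Proof.
apply: contrapT => nM.
(* The function y_n attains 3/4 of the norm of its functional, whence 4/3. Below, with c_n =
   3^-(n+1), the partial sum [g n.+1] has integral at least c_n |T y_n| >= 3n in absolute value; the
   tail, of size c_n / 2, changes it by at most 2/3 of c_n |T y_n|, so that at least n is left. *)
have step n : exists p : I * (K -> R), [/\ cts p.2, forall x, `|p.2 x| <= 1,
    9 * 3 ^+ n * n%:R <= `|T p.2 p.1| &
    forall f c, cts f -> 0 < c -> (forall x, `|f x| <= c) ->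
      `|T f p.1| <= 4 / 3 * `|T p.2 p.1| * c].
  pose B : R := 9 * 3 ^+ n * n%:R.
  have B0 : 0 <= B by rewrite /B !mulr_ge0 ?exprn_ge0.
  have [i [f [cf f1 Bf]]] : exists i f, [/\ cts f, forall x, `|f x| <= 1 & 2 * (B + 1) < `|T f i|].
    apply: contrapT => nf; apply: nM; exists (2 * (B + 1)) => i f cf f1.
    by rewrite leNgt; apply/negP => h; apply: nf; exists i, f.
  pose A : set R := [set t | exists g, [/\ cts g, forall x, `|g x| <= 1 & t = `|T g i|]].
  have [V [V0 hV]] := integral_bound (bvF i).
  have supA : has_sup A.
    split; first by exists `|T f i|, f.
    exists (V * 1) => _ [g [cg g1 ->]]; apply: hV g1 _ => //.
    exact: (TP cg).1.
  have ubA g : cts g -> (forall x, `|g x| <= 1) -> `|T g i| <= sup A.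
    by move=> cg g1; apply: (ub_le_sup supA.2); exists g.
  have fA := ubA f cf f1.
  have [|_ [y [cy y1 ->]] hy] := @sup_adherent _ A (sup A / 4) _ supA.
    by rewrite divr_gt0//; lra.
  exists (i, y); split=> //=; first by rewrite -/B; lra.
  move=> g c cg c0 gc.
  have := ubA (fun x => c^-1 * g x).
  have cg' : cts (fun x => c^-1 * g x).
    have := ocont_lin (c := c^-1) (ocont_cst (c := 0)) cg.
    by congr ocont; apply/funext => x; rewrite add0r.
  move=> /(_ cg'); rewrite T_scale// normrM normfV (gtr0_norm c0) => h.
  have {h} : c^-1 * `|T g i| <= sup A.
    apply: h => x; rewrite normrM normfV (gtr0_norm c0) mulrC ler_pdivrMr// mul1r.
    exact: gc.
  rewrite mulrC ler_pdivrMr// => h; apply: le_trans h _; rewrite ler_wpM2r ?ltW//.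
  lra.
have [p hp] := choice step.
pose c n : R := (3^-1) ^+ n.+1.
have cn0 n : 0 < c n by rewrite exprn_gt0// invr_gt0.
(* One of |a + v| and |a - v| is at least |v|, as their sum is at least 2|v|. *)
pose sg n (h : K -> R) := if c n * `|T (p n).2 (p n).1| <=
  `|T h (p n).1 + c n * T (p n).2 (p n).1| then c n else - c n.
pose g := fix g n : K -> R := if n is m.+1 then
  (fun x => g m x + sg m (g m) * (p m).2 x) else (fun=> 0).
have sgE n h : `|sg n h| = c n.
  by rewrite /sg; case: ifP => _; rewrite ?normrN gtr0_norm.
have cg n : cts (g n).
  elim: n => [|n IH]; first exact: ocont_cst.
  by apply: ocont_lin => //; case: (hp n).
have Tg n : c n * `|T (p n).2 (p n).1| <= `|T (g n.+1) (p n).1|.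
  rewrite /= T_lin//; last by case: (hp n).
  have := sgE n (g n); rewrite /sg; case: ifPn => //; rewrite -ltNge => h _.
  move: h; set a := T (g n) _; set b := T (p n).2 _ => h.
  have : `|c n * b| = c n * `|b| by rewrite normrM gtr0_norm.
  move: h; have := cn0 n; rewrite mulNr; move: (c n * `|b|) (c n * b) => u v _ h vu.
  have := ler_normB (a + v) (a - v).
  have -> : a + v - (a - v) = 2 * v by lra.
  by rewrite normrM vu ger0_norm//; lra.
have [f hf] : exists f : K -> R, forall x n, `|f x - g n x| <= (3^-1) ^+ n / 2.
  have lim x : exists l, forall n, `|l - g n x| <= (3^-1 : R) ^+ n / 2.
    apply: nested_limit => n; first by rewrite divr_ge0// exprn_ge0// invr_ge0.
    rewrite /= addrAC subrr add0r normrM sgE.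
    have [_ y1 _ _] := hp n; have := ler_wpM2l (ltW (cn0 n)) (y1 x).
    by rewrite /c !exprS; lra.
  by have [f hf] := choice lim; exists f.
have cf : cts f.
  apply: (ocont_uniform_limit cg) => e e0.
  have [n hn] := half_expn_lt e0; exists n => x.
  apply: le_trans (hf x n) _; apply: le_trans (ltW hn).
  have : (3^-1 : R) ^+ n <= 2^-1 ^+ n by apply: lerXn2r; rewrite ?nnegrE; lra.
  have : 0 <= (3^-1 : R) ^+ n by rewrite exprn_ge0// invr_ge0.
  lra.
have [B hB] := c0_bounded (TP cf).2.
have big n : n%:R <= `|T f (p n).1|.
  have [cy y1 Ty Tn] := hp n.
  have cd : cts (fun x => f x + (-1) * g n.+1 x) by exact: ocont_lin.
  have h : `|T f (p n).1 - T (g n.+1) (p n).1| <= 4 / 3 * `|T (p n).2 (p n).1| * (c n / 2).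
    rewrite -mulN1r -T_lin//; apply: Tn => //; first by rewrite divr_gt0.
    by move=> x; rewrite mulN1r; exact: hf.
  have h2 := Tg n.
  have h3 : c n * (9 * 3 ^+ n * n%:R) <= c n * `|T (p n).2 (p n).1| by rewrite ler_wpM2l// ltW.
  have E : c n * (9 * 3 ^+ n * n%:R) = 3 * n%:R.
    rewrite /c exprS exprVn; have : (3 ^+ n : R) != 0 by rewrite expf_neq0// pnatr_eq0.
    by move: (3 ^+ n : R) => z z0; field.
  rewrite E in h3.
  have h4 := ler_normB (T f (p n).1) (T f (p n).1 - T (g n.+1) (p n).1).
  by rewrite subKr in h4; lra.
have B0 : 0 <= B by exact: le_trans (hB (p 0%N).1).
have := archi_boundP B0; rewrite ltNge => /negP; apply.
exact: le_trans (big _) (hB _).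
Qed.

End UniformBoundedness.

Lemma infinite_injection (I : Type) (A : set I) : infinite_set A ->
  exists g : nat -> I, injective g /\ forall n, A (g n).
Proof.
move=> /infiniteP /card_leP [g].
exists (fun n => val (g (SigSub (mem_set (Logic.I : [set: nat] n))))); split.
  move=> a b /val_inj ab; have := inj (f := g) _ _ ab.
  by rewrite !inE => /(_ Logic.I Logic.I) /(congr1 val).
by move=> n; exact: set_mem (valP _).
Qed.

(** * Variation bound, countable supports and finite sums *)

Section WeakNull.
Context {R : realType} {d : Order.disp_t} {K : orderType d} {I : Type}.
Variables (F : I -> K -> R) (T : (K -> R) -> I -> R).
Local Notation cts := (ocont [set: K] [set: R]).
Hypothesis NBVF : forall i, NBV [set: K] (F i).
Hypothesis TP : forall f, cts f -> (forall i, stieltjes_int [set: K] (F i) f (T f i)) /\ c0 (T f).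

Lemma right_near i x y (e : R) : 0 < e -> (x < y)%O ->
  exists u, [/\ (x < u)%O, (u <= y)%O & forall s, (x <= s)%O -> (s < u)%O -> `|F i s - F i x| < e].
Proof.
move=> e0 xy; have [/(_ x Logic.I e e0) [h|[u [_ xu h]]] _] := NBVF i.
  by have := h y Logic.I; rewrite leNgt xy.
exists (Order.min u y); split; [by rewrite lt_min xu|by rewrite ge_min lexx orbT|].
by move=> s xs; rewrite lt_min => /andP[su _]; exact: h.
Qed.

Lemma cut_near i x y (e : R) : 0 < e -> (x < y)%O -> exists f, cut x y f /\ `|T f i - F i x| <= e.
Proof.
move=> e0 xy; have [u [xu uy h]] := right_near i e0 xy.
have [f cf] := exists_cut (R := R) xu; exists f; split.
  by case: cf => ? ? ? h0; split=> // z yz; apply: h0; exact: le_trans yz.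
have [cf' _ _ _] := cf.
apply: integral_cut_near ((TP cf').1 i) cf _ => s xs su.
exact/ltW/h.
Qed.

Lemma T_one i m : (forall y : K, (y <= m)%O) -> T (fun=> 1) i = F i m.
Proof.
by move=> /integral_cst h; rewrite (h _ _ _ _ ((TP (ocont_cst (c := 1))).1 i)) mul1r.
Qed.

Lemma cut_near_any i x (e : R) : 0 < e -> exists f, [/\ cts f, forall z, 0 <= f z <= 1,
  forall z, (z <= x)%O -> f z = 1 & `|T f i - F i x| <= e].
Proof.
move=> e0; have [mx|/existsNP [y /negP]] := pselect (forall y, (y <= x)%O).
  exists (fun=> 1); split=> //; [exact: ocont_cst|by move=> z; rewrite ler01 lexx|].
  by rewrite (T_one i mx) subrr normr0 ltW.
rewrite -ltNge => xy; have [f [cf h]] := cut_near i e0 xy; exists f.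
have [? _ ? _] := cf; split=> // z.
by rewrite (cut_ge0 _ cf) (cut_le1 _ cf).
Qed.

(** The test function [h] adds up signed differences of cuts at consecutive points. Keeping |h| <= 1
    - f, with [f] attached to the first point, leaves room for the next difference and ensures |h|
    <= 1. *)
Lemma chain_var_test i (e : R) p s : 0 < e -> sorted <%O (p :: s) -> exists f h,
  [/\ cts f, cts h, (forall z, 0 <= f z <= 1) /\ (forall z, (z <= p)%O -> f z = 1),
      forall z, `|h z| <= 1 - f z &
      `|T f i - F i p| <= e /\ chain_var (F i) (p :: s) <= T h i + e].
Proof.
elim: s p e => [|q s IH] p e e0.
  move=> _; have [f [cf f01 f1 fF]] := cut_near_any i p e0.
  exists f, (fun=> 0 * f p); split=> //; first exact: ocont_cst.
    by move=> z; rewrite mul0r normr0; have := f01 z; lra.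
  split=> //; rewrite chain_var1.
  have c1 : cts (fun=> 1 : R) by exact: ocont_cst.
  have -> : (fun=> 0 * f p) = (fun _ : K => 0 * 1) by apply/funext => z; rewrite !mul0r.
  by rewrite (T_scale TP)// mul0r add0r ltW.
move=> pqs; have /andP[pq qs] : (p < q)%O && path <%O q s := pqs.
have e3 : 0 < e / 3 by rewrite divr_gt0.
have [f2 [h2 [cf2 ch2 [f2_01 f2_1] h2f2 [fF2 var2]]]] := IH q _ e3 qs.
have [f [cf fF]] := cut_near i e3 pq.
have [cf' fhomo f1 f0] := cf.
have ff2 z : f z <= f2 z.
  have [zq|/ltW qz] := leP z q; first by rewrite f2_1// (cut_le1 _ cf).
  by rewrite f0//; have := f2_01 z; lra.
pose sg : R := if F i p <= F i q then 1 else -1.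
have sg1 : `|sg| <= 1 by rewrite /sg; case: ifP => _; rewrite ?normrN normr1.
exists f, (fun z => h2 z + sg * (f2 z + (-1) * f z)); split=> //.
- by do 2?apply: ocont_lin.
- by split=> // z; rewrite (cut_ge0 _ cf) (cut_le1 _ cf).
- move=> z; apply: le_trans (ler_normD _ _) _; rewrite normrM.
  have := h2f2 z; have := ff2 z; rewrite mulN1r => h3 h4.
  have h5 : 0 <= f2 z - f z by lra.
  by rewrite (ger0_norm h5); nra.
split; first by apply: le_trans fF _; lra.
have cff : cts (fun z => f2 z + (-1) * f z) by exact: ocont_lin.
rewrite (T_lin TP)// (T_lin TP)// mulN1r chain_var_cons2; move: fF fF2 var2; rewrite !ler_norml /sg.
have [h|h] := leP (F i p) (F i q).
  by rewrite ger0_norm ?subr_ge0//; lra.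
by rewrite ltr0_norm ?subr_lt0//; lra.
Qed.

Lemma variation_bound : exists M : R, forall i p s, sorted <%O (p :: s) ->
  `|F i p| <= M /\ chain_var (F i) (p :: s) <= M.
Proof.
have [M hM] := uniform_boundedness (fun i => (NBVF i).2) TP.
exists M => i p s ps; suff h e : 0 < e -> `|F i p| <= M + e /\ chain_var (F i) (p :: s) <= M + e.
  by split; apply/ler_addgt0Pr => e e0; case: (h e e0).
move=> e0; have [f [h [cf ch [f01 _] hf [fF hF]]]] := chain_var_test i e0 ps; split.
  have : `|T f i| <= M by apply: hM => // x; have := f01 x; rewrite ler_norml; lra.
  by have := ler_normB (T f i) (T f i - F i p); rewrite subKr; lra.
have : `|T h i| <= M.
  by apply: hM => // x; have := hf x; have := f01 x; lra.
by rewrite ler_norml; lra.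
Qed.

(* If s is a limit of a sequence from the right, F_i(s) is determined by countably many integrals
   of continuous functions; otherwise each of countably many F_i is constant on a common
   right neighbourhood of s. *)
Lemma countable_nonzero s m : (forall y : K, (y <= m)%O) -> countable [set i | F i s != 0].
Proof.
move=> mm; have [sm|] := eqVneq s m.
  have := c0_countable (TP (ocont_cst (c := 1))).2; apply: sub_countable; apply: subset_card_le.
  by move=> i /=; rewrite (T_one i mm) sm.
rewrite neq_lt (ltNge m) mm orbF => {mm}sm.
have [[u [su hu]]|nu] := pselect (exists u : nat -> K, (forall n, (s < u n)%O) /\
    forall y, (s < y)%O -> exists n, (u n <= y)%O).
  have [f hf] := choice (fun n => exists_cut (R := R) (su n)).
  apply: (@sub_countable _ _ _ (\bigcup_n [set i | T (f n) i != 0])); last first.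
    by apply: bigcup_countable => // n _; apply: c0_countable; case: (hf n) => /TP[].
  apply: subset_card_le => i /= Fi; apply: contrapT => nT.
  have T0 n : T (f n) i = 0.
    by apply/eqP; apply: contrapT => /negP h; apply: nT; exists n.
  move/eqP: Fi; apply; apply/eqP; rewrite -normr_le0; apply/ler_addgt0Pr => e e0.
  have [y [sy _ hy]] := right_near i e0 sm.
  have [n uy] := hu y sy; rewrite add0r -normrN -sub0r -(T0 n).
  have [cf _ _ _] := hf n.
  apply: integral_cut_near ((TP cf).1 i) (hf n) _ => w sw wu.
  by apply/ltW/hy => //; exact: lt_le_trans wu uy.
have {}nu (u : nat -> K) : (forall n, (s < u n)%O) -> exists2 y, (s < y)%O & forall n, (y <= u n)%O.
  move=> su; apply: contrapT => ny; apply: nu; exists u; split=> // y sy.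
  apply: contrapT => nn; apply: ny; exists y => // n.
  by rewrite leNgt; apply/negP => /ltW uy; apply: nn; exists n.
(* Infinitely many values of size at least [e] at [s] would give, on a common right neighbourhood,
   infinitely many integrals of size at least [e] of a single cut. *)
apply: c0_countable => e e0; apply: contrapT => /infinite_injection [g [ginj ge]].
(* No sequence is coinitial above [s], so the right neighbourhoods for the errors 2^-n contain a
   common one, on which F_i must be constant. *)
have cst i : exists u, (s < u)%O /\ forall w, (s <= w)%O -> (w < u)%O -> F i w = F i s.
  have hn n := right_near i (half_expn_gt0 R n) sm.
  have [u hu] := choice hn.
  have [|y sy yu] := nu u; first by move=> n; case: (hu n).
  exists y; split=> // w sw wy; apply/eqP; rewrite -subr_eq0 -normr_le0.
  apply: (@le0_half_expn R _ 1) => // n; rewrite mul1r; have [_ _ h] := hu n.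
  by apply/ltW/h => //; exact: lt_le_trans wy (yu n).
have [u hu] := choice (fun n => cst (g n)).
have [|y sy yu] := nu u; first by move=> n; case: (hu n).
have [f cf] := exists_cut (R := R) sy.
have [cf' _ _ _] := cf; have [Ti /(_ _ e0) fin] := TP cf'.
have : finite_set (g @` [set: nat]).
  apply: sub_finite_set fin => _ [n _ <-] /=; suff -> : T f (g n) = F (g n) s by exact: ge.
  apply/eqP; rewrite -subr_eq0 -normr_le0; apply: integral_cut_near (Ti (g n)) cf _ => w sw wy.
  have [_ ->] := hu n; rewrite ?subrr ?normr0//; exact: lt_le_trans wy (yu n).
rewrite (eq_finite_set (inj_card_eq _)); first exact: infinite_nat.
by move=> a b _ _; exact: ginj.
Qed.

(** For all but finitely many i, the integral of a cut between consecutive points p < q is below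
    eps/4, so [integral_cut_jump] yields u in [p, q) with |F_i(p)| <= eps/2 + |F_i(u) - F_i(p)|.
    Inserting these u into the chain bounds the sum by a variation; [M] takes care of the last
    point. *)
Lemma finite_sum_chain (M eps : R) p s : (forall i x, `|F i x| <= M) -> 0 < eps ->
  sorted <%O (p :: s) -> finite_set [set i | ~ exists c, sorted <%O (p :: c) /\
     \sum_(x <- p :: s) `|F i x| <= chain_var (F i) (p :: c) + M + eps].
Proof.
move=> FM; elim: s p eps => [|q s IH] p eps eps0.
  move=> _; apply: sub_finite_set (@finite_set0 I) => i ni; case: ni.
  by exists [::]; rewrite big_cons big_nil chain_var1; split=> //; have := FM i p; lra.
move=> pqs; have /andP[pq qs] : (p < q)%O && path <%O q s := pqs.
have eps4 : 0 < eps / 4 by rewrite divr_gt0.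
have [f cf] := exists_cut (R := R) pq.
have [cf' _ _ _] := cf; have [Ti c0T] := TP cf'.
have eps2 : 0 < eps / 2 by rewrite divr_gt0.
have := IH q _ eps2 qs; have := c0T _ eps4.
move=> fin1 fin2; have := conj fin1 fin2; rewrite -finite_setU; apply: sub_finite_set => i ni.
have [Tf|Tf] := leP (eps / 4) `|T f i|; first by left.
right=> -[c [qc hc]]; case: ni.
have [u [pu uq hu]] := integral_cut_jump (Ti i) cf eps4.
(* If u = p, then |F_i(p)| <= eps/2 and no point is inserted. *)
have [pu'|pu'] := eqVneq u p.
  exists (q :: c); split; first by rewrite /= pq; exact: qc.
  rewrite big_cons chain_var_cons2; have := normr_ge0 (F i q - F i p).
  by move: hu; rewrite pu' subrr normr0; lra.
exists [:: u, q & c]; split; first by rewrite /= uq lt_neqAle pu eq_sym pu'; exact: qc.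
by rewrite big_cons 2!chain_var_cons2; have := normr_ge0 (F i q - F i u); lra.
Qed.

Lemma finite_sum_large : exists M, forall s : seq K, uniq s ->
  finite_set [set i | M < \sum_(x <- s) `|F i x|].
Proof.
have [M hM] := variation_bound.
have FM i x : `|F i x| <= M by case: (hM i x [::] isT).
(* One [|M|] is for the variation, one for the value at the last point, and 1 is the value of
   [eps]. *)
exists (`|M| + `|M| + 1) => s us; pose s' := sorted_part s.
have E i : \sum_(x <- s) `|F i x| = \sum_(x <- s') `|F i x|.
  apply: perm_big; rewrite perm_sym uniq_perm//; last exact: mem_sorted_part.
  by rewrite sort_uniq undup_uniq.
have := sorted_part_lt s; rewrite -/s'; case: s' E => [|p l] E sl.
  apply: sub_finite_set (@finite_set0 I) => i /=; rewrite E big_nil.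
  by have := normr_ge0 M; lra.
have := finite_sum_chain FM (@ltr01 R) sl; apply: sub_finite_set => i h [c [pc hc]]; move: h => /= h.
have [_ h2] := hM i p c pc; have := ler_norm M.
by rewrite E in h; lra.
Qed.

End WeakNull.

Lemma ler_sum_uniq (R : numDomainType) (T : eqType) (l r : seq T) (f : T -> R) :
  (forall x, 0 <= f x) -> uniq l -> uniq r -> {subset l <= r} ->
  \sum_(x <- l) f x <= \sum_(x <- r) f x.
Proof.
move=> f0 ul ur lr; have lE : perm_eq l [seq x <- r | x \in l].
  apply: uniq_perm; rewrite ?filter_uniq// => x.
  by rewrite mem_filter; case: (boolP (x \in l)) => // /lr ->.
by rewrite (perm_big _ lE) big_filter [leRHS](bigID (mem l)) /= lerDl sumr_ge0.
Qed.

(** * Families with countable supports *)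

Section Components.
Context {I T : Type}.
Variable S : I -> set T.
Hypothesis cS : forall i, countable (S i).
Hypothesis cS' : forall s, countable [set i | S i s].

(** Points are adjacent when some [S i] contains both. Writing a component as a union of balls makes
    it countable by induction on the radius. *)
Let step (A : set T) := A `|` \bigcup_(s in A) \bigcup_(i in [set i | S i s]) S i.
Let ball n s := iter n step [set s].

Definition component (s : T) : set T := \bigcup_n ball n s.

Lemma component_refl s : component s s.
Proof. by exists 0%N. Qed.

Lemma component_closed s t t' i : component s t -> S i t -> S i t' -> component s t'.
Proof. by move=> [n _ nt] St St'; exists n.+1 => //; right; exists t => //; exists i. Qed.

Lemma component_eq i s t : S i s -> S i t -> component s = component t.
Proof.
suff h s' t' : S i s' -> S i t' -> component t' `<=` component s'.
  by move=> Ss St; apply/seteqP; split; exact: h.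
move=> Ss St; have tt : component s' t' by apply: component_closed (component_refl _) Ss St.
move=> x [n _]; elim: n x => [|n IH] x /=; first by move=> ->.
by move=> [/IH //|[y /IH yy [j jy jx]]]; exact: component_closed yy jy jx.
Qed.

Lemma countable_component s : countable (component s).
Proof.
apply: bigcup_countable => // n _; elim: n => [|n IH]; first exact: countable1.
rewrite /ball /= /step -bigcup2E; apply: bigcup_countable => //.
move=> [|[|k]] _ //=; apply: bigcup_countable => // t _.
by apply: bigcup_countable => [|i _]; [exact: cS'|exact: cS].
Qed.

(** The enumeration is chosen for the component as a set, so that all points of one component are
    coded by the same injection. *)
Lemma component_code : exists code : T -> nat,
  forall s t, component s = component t -> code s = code t -> s = t.
Proof.
have h (A : set T) : exists f : T -> nat, countable A -> {in A &, injective f}.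
  have [/countable_injP [f hf]|nc] := pselect (countable A); first by exists f.
  by exists (fun=> 0%N).
have [e he] := choice h.
exists (fun s => e (component s) s) => s t st; rewrite -st => est.
apply: (he _ (countable_component s)) est; rewrite inE; first exact: component_refl.
by rewrite st; exact: component_refl.
Qed.

End Components.

Section KeyLemma.
Context {R : realType} {d : Order.disp_t} {K : orderType d} {I : Type}.
Variables (F : I -> K -> R) (T : (K -> R) -> I -> R).
Local Notation cts := (ocont [set: K] [set: R]).
Hypothesis NBVF : forall i, NBV [set: K] (F i).
Hypothesis TP : forall f, cts f -> (forall i, stieltjes_int [set: K] (F i) f (T f i)) /\ c0 (T f).
Hypothesis maxK : K -> exists m : K, forall y : K, (y <= m)%O.

(* The bipartite graph joining i to the points s with b_i(s) <> 0 <> F_i(s) is locally countable, so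
   its components are countable; inside one component b_i(s) = F_i(s) is kept as soon as i
   has small sums over the finitely many points coded before s. *)
Lemma type_c0l1_of_countable_support (Q : set K) (a b : I -> K -> R) :
  (forall i s, Q s -> F i s = a i s + b i s) -> (forall s, Q s -> c0 (a^~ s)) ->
  (forall i, countable [set s | Q s /\ b i s != 0]) -> type_c0l1 Q F.
Proof.
move=> Fab a0 bc; have [M hM] := finite_sum_large NBVF TP.
pose S i := [set s | [/\ Q s, b i s != 0 & F i s != 0]].
have cS i : countable (S i).
  by apply: sub_countable (bc i); apply: subset_card_le => s [].
have cS' s : countable [set i | S i s].
  have [m mm] := maxK s; apply: sub_countable (countable_nonzero NBVF TP s mm).
  by apply: subset_card_le => i [].
have [code hcode] := component_code cS cS'.
pose C := component S.
pose small i s := forall l : seq K, uniq l ->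
  (forall x, x \in l -> C x = C s /\ (code x <= code s)%N) -> \sum_(x <- l) `|F i x| <= M.
pose b' i s := if `[< S i s /\ small i s >] then F i s else 0.
exists (fun i s => F i s - b' i s), b'; split.
- by move=> i s _; rewrite subrK.
(* Only finitely many points of the component have code at most that of [s], so by the choice of [M]
   smallness at [s] fails for finitely many i. For the others, [F i s - b' i s] is 0 or [a i s]. *)
- move=> s Qs; apply: (@c0_sub _ _ _ [set i | ~ small i s] (a^~ s)); [|exact: a0|].
    pose A := [set x | C x = C s /\ (code x <= code s)%N].
    have /finite_seqP [r hr] : finite_set A.
      have <- : finite_set (code @` A) = finite_set A.
        apply: eq_finite_set; apply: inj_card_eq => x y; rewrite !inE => -[xs _] [ys _] xy.
        by apply: hcode => //; rewrite -/C xs ys.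
      by apply: sub_finite_set (finite_II (code s).+1) => _ [x [_ ?] <-] /=.
    apply: sub_finite_set (hM (undup r) (undup_uniq r)) => i ns /=.
    rewrite ltNge; apply/negP => le; apply: ns => l ul lA; apply: le_trans le.
    apply: ler_sum_uniq => //; first exact: undup_uniq.
    by move=> x /lA Ax; rewrite mem_undup; have /(congr1 (@^~ x)) /= <- := hr.
  move=> i /contrapT si; rewrite /b'; case: asboolP => [_|nS]; first by rewrite subrr normr0.
  rewrite subr0; have [->|Fn0] := eqVneq (F i s) 0; first by rewrite normr0.
  have [bn0|bn0] := eqVneq (b i s) 0; first by rewrite (Fab _ _ Qs) bn0 addr0.
  by case: nS; split.
exists `|M| => i l ul lQ.
rewrite (bigID (fun x => b' i x == 0)) /= big1 ?add0r; last by move=> x /eqP ->; rewrite normr0.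
(* The support of [b' i] lies in [S i], hence in one component. Smallness at the point of largest
   code in [l'] bounds the whole sum. *)
rewrite -big_filter; set l' := [seq _ <- _ | _].
have hl' x : x \in l' -> S i x /\ small i x.
  rewrite mem_filter => /andP[+ _]; rewrite /b'; case: asboolP => //.
  by rewrite eqxx.
have [l0|[t tl tmax]] : l' = [::] \/ exists2 t, t \in l' & forall x, x \in l' -> (code x <= code t)%N.
  elim: l' {hl'} => [|x l' [->|[t tl ht]]]; first by left.
    by right; exists x; [rewrite mem_head|move=> y; rewrite inE => /eqP ->].
  right; have [xt|/ltnW tx] := leqP (code x) (code t).
    by exists t; [rewrite inE tl orbT|move=> y; rewrite inE => /orP[/eqP ->//|/ht]].
  exists x; first exact: mem_head.
  by move=> y; rewrite inE => /orP[/eqP ->//|/ht yt]; exact: leq_trans yt tx.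
  by rewrite l0 big_nil.
have [St smt] := hl' t tl.
have : \sum_(x <- l') `|F i x| <= M.
  apply: smt => [|x xl]; first exact: filter_uniq.
  by split; [have [Sx _] := hl' x xl; exact: component_eq Sx St|exact: tmax].
rewrite (_ : \sum_(x <- l') `|F i x| = \sum_(x <- l') `|b' i x|).
  by move/le_trans; apply; exact: ler_norm.
apply: eq_big_seq => x /hl' h; rewrite /b'; case: asboolP => //.
Qed.

End KeyLemma.

(** A dropped point p contributes (f p - f q) F(p), with q the next point; this is 0 because [f] is
    constant from p up to a kept point beyond p. *)
Lemma rs_sum_filter (R : realType) (d : Order.disp_t) (K : orderType d)
  (F f : K -> R) (D : pred K) (l : seq K) : sorted <%O l ->
  (forall p, p \in l -> ~~ D p -> exists p', [/\ p' \in l, D p', (p < p')%O &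
     forall q, q \in l -> (p <= q)%O -> (q <= p')%O -> f q = f p]) ->
  rs_sum F f (filter D l) = rs_sum F f l.
Proof.
elim: l => [//|p l IH] pl hD.
have sl : sorted <%O l by exact: path_sorted pl.
have pq q : q \in l -> (p < q)%O.
  by move=> ql; move: pl; rewrite /= lt_path_sortedE => /andP[/allP /(_ _ ql)].
have {}IH : rs_sum F f (filter D l) = rs_sum F f l.
  apply: IH => // q ql nDq; have [|q' [q'l Dq' qq' h]] := hD q _ nDq.
    by rewrite inE ql orbT.
  exists q'; split=> //.
    move: q'l; rewrite inE => /orP[/eqP q'p|//].
    by move: qq'; rewrite q'p ltNge ltW ?pq.
  by move=> r rl; apply: h; rewrite inE rl orbT.
case: l sl pq IH pl hD => [|q l] sl pq IH pl hD /=.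
  case: ifPn => // nDp; have [|p' []] := hD p _ nDp; first exact: mem_head.
  by rewrite inE => /eqP -> _; rewrite ltxx.
rewrite -[if D q then _ else _]/(filter D (q :: l)).
rewrite -[RHS]/(rs_sum F f [:: p, q & l]) rs_sum_cons2.
case: ifPn => Dp; last first.
  rewrite IH; have [|p' [p'l Dp' pp' h]] := hD p _ Dp; first exact: mem_head.
  rewrite (h q) ?subrr ?mul0r ?add0r//; first by rewrite !inE eqxx orbT.
    by rewrite ltW// pq ?mem_head.
  move: p'l; rewrite inE => /orP[/eqP p'p|p'l]; first by move: pp'; rewrite p'p ltxx.
  exact: head_le sl p'l.
have sf : sorted <%O (filter D (q :: l)) by apply: lt_sorted_filter.
have mf x : x \in filter D (q :: l) -> x \in q :: l by rewrite mem_filter => /andP[].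
have [Dq|nDq] := boolP (D q).
  by rewrite -IH /= Dq -/(rs_sum F f [:: p, q & filter D l]) rs_sum_cons2.
have [|q' [q'l Dq' qq' h]] := hD q _ nDq; first by rewrite !inE eqxx orbT.
have {}q'l : q' \in filter D (q :: l).
  rewrite mem_filter Dq'; move: q'l; rewrite inE => /orP[/eqP q'p|//].
  by move: qq'; rewrite q'p ltNge ltW ?pq ?mem_head.
rewrite -IH; case: (filter D (q :: l)) q'l sf mf => [//|r l'] q'l sf mf.
rewrite -[LHS]/(rs_sum F f [:: p, r & l']) rs_sum_cons2 (h r)//.
- by rewrite inE mf ?orbT ?mem_head.
- by apply: head_le sl _; rewrite mf ?mem_head.
- exact: head_le sf q'l.
Qed.

(** * Push-forward along an increasing map *)

Section Pushforward.
Context {R : realType} {d d' : Order.disp_t} {K : orderType d} {Y : orderType d'}.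
Variables (X : set Y) (psi : K -> Y) (beta : Y -> K).
Hypothesis psi_homo : {homo psi : x y / (x <= y)%O}.
Hypothesis psiX : forall x, X (psi x).
Hypothesis psiK : forall t, X t -> psi (beta t) = t.
Hypothesis psi_max : forall x, (x <= beta (psi x))%O.

(** As [beta t] is the largest point of the fibre over [t], preimages of closed initial segments are
    closed initial segments; this is why [F \o beta] represents the image measure. *)
Lemma psi_le x t : X t -> (psi x <= t)%O = (x <= beta t)%O.
Proof.
move=> Xt; apply/idP/idP => [xt|/psi_homo]; last by rewrite psiK.
rewrite leNgt; apply/negP => tx.
have tE : psi x = t by apply/le_anti; rewrite xt -{1}(psiK Xt) psi_homo// ltW.
by move: tx; rewrite ltNge -tE psi_max.
Qed.

Lemma beta_lt s t : X s -> X t -> (s < t)%O -> (beta s < beta t)%O.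
Proof. by move=> Xs Xt; rewrite !ltNge -psi_le// psiK. Qed.

Lemma NBV_pushforward (F : K -> R) : NBV [set: K] F -> NBV X (F \o beta).
Proof.
move=> [rc [M bv]]; split.
  move=> t Xt e e0; have [h|[u [_ tu h]]] := rc (beta t) I e e0.
    by left=> s Xs; rewrite -(psiK Xs) psi_le// h.
  right; exists (psi u); split=> //; first by rewrite ltNge psi_le// -ltNge.
  move=> s Xs ts su /=; apply: h => //; first by rewrite -psi_le// psiK.
  by rewrite ltNge -psi_le// -ltNge.
exists M => s sX ss.
have -> : chain_var (F \o beta) s = chain_var F (map beta s).
  elim: s {sX ss} => [//|p [//|q s] IH].
  by rewrite chain_var_cons2 IH /= -/(chain_var F [:: beta p, beta q & map beta s]) chain_var_cons2.
apply: bv => //; apply: (homo_sorted_in (P := mem X)) ss.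
  by move=> x y; rewrite !inE; exact: beta_lt.
by apply/allP => x /sX Xx; rewrite inE.
Qed.

Lemma rs_sum_pushforward (F : K -> R) (g : Y -> R) s : (forall t, t \in s -> X t) ->
  rs_sum F (g \o psi) (map beta s) = rs_sum (F \o beta) g s.
Proof.
elim: s => [//|p [|q s] IH] sX; have Xp := sX p (mem_head _ _).
  by rewrite [map _ _]/= !rs_sum1 /= psiK.
have Xq : X q by apply: sX; rewrite !inE eqxx orbT.
rewrite [RHS]rs_sum_cons2 -IH => [|t ts]; last by apply: sX; rewrite inE ts orbT.
by rewrite [map _ _]/= rs_sum_cons2 /= !psiK.
Qed.

(** Add the points of [P0] to [map beta s]. Each added p has [psi p] in [s], and [g \o psi] is
    constant from p to [beta (psi p)], so [rs_sum_filter] removes p at no cost. *)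
Lemma integral_pushforward (F : K -> R) (g : Y -> R) v :
  stieltjes_int [set: K] F (g \o psi) v -> stieltjes_int X (F \o beta) g v.
Proof.
move=> /stieltjes_intP h; apply/stieltjes_intP => e /h [P0 [_ hP]].
exists (map psi P0); split=> [_ /mapP[x _ ->]//|s ss Ps sX].
pose l := sorted_part (map beta s ++ P0).
have bs : sorted <%O (map beta s).
  apply: (homo_sorted_in (P := mem X)) ss.
    by move=> x y; rewrite !inE; exact: beta_lt.
  by apply/allP => x /sX Xx; rewrite inE.
have fl : filter (mem (map beta s)) l = map beta s.
  apply: lt_sorted_eq => //; first by apply: lt_sorted_filter; exact: sorted_part_lt.
  move=> x; rewrite mem_filter mem_sorted_part mem_cat /=.
  by case: (x \in map beta s).
have -> : rs_sum (F \o beta) g s = rs_sum F (g \o psi) l.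
  rewrite -rs_sum_pushforward// -fl; apply: rs_sum_filter; first exact: sorted_part_lt.
  move=> p; rewrite mem_sorted_part mem_cat => /orP[pm|pP] nDp; first by rewrite /= pm in nDp.
  have ps : psi p \in s by apply: Ps; exact: map_f.
  exists (beta (psi p)); split.
  - by rewrite mem_sorted_part mem_cat map_f.
  - by rewrite /= map_f.
  - rewrite lt_neqAle psi_max andbT; apply/eqP => pE.
    by move: nDp; rewrite pE /= map_f.
  - move=> q _ pq qp /=; congr g; apply/le_anti.
    by rewrite psi_le// qp psi_homo.
apply: hP => //; first exact: sorted_part_lt.
by move=> x xP; rewrite mem_sorted_part mem_cat xP orbT.
Qed.

Lemma weakstar_null_pushforward (I : Type) (F : I -> K -> R) : ocont [set: K] X psi ->
  weakstar_null [set: K] F -> weakstar_null X (fun i => F i \o beta).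
Proof.
move=> cpsi wF g cg; have [|v [Fv c0v]] := wF (g \o psi).
  by move=> B /cg /cpsi.
by exists v; split=> // i; exact: integral_pushforward.
Qed.

End Pushforward.

(** * Closed separable subsets and fibres *)

Section Closure.
Context {d : Order.disp_t} {K : orderType d}.

Lemma subset_oclosure (D : set K) : D `<=` oclosure [set: K] D.
Proof. by move=> x Dx; split=> // U _ Ux; exists x. Qed.

Lemma oclosed_oclosure (D : set K) : oclosed [set: K] (oclosure [set: K] D).
Proof.
split=> // x _ [_ nx].
have [U [oU [Ux UD]]] : exists U, oopen [set: K] U /\ U x /\ forall y, D y -> ~ U y.
  apply: contrapT => nU; apply: nx; split=> // U oU Ux; apply: contrapT => ny.
  by apply: nU; exists U; split=> //; split=> // y Dy Uy; apply: ny; exists y.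
have [lo [hi [lx hx h]]] := oU x I Ux; exists lo, hi; split=> // y _ ly hy; split=> //.
by move=> [_ /(_ U oU (h y I ly hy))] [z [Dz Uz]]; exact: UD Uz.
Qed.

Lemma oseparable_oclosure (D : set K) : countable D ->
  oseparable [set: K] (oclosure [set: K] D).
Proof. by move=> cD; exists D; split=> //; exact: subset_oclosure. Qed.

(** The infimum of the points of [H] above [t] belongs to [H] by closedness and is at least [u],
    hence is an immediate successor of [t]. *)
Lemma rplus_of_gap (H : set K) (t u h : K) : ocompact [set: K] -> oclosed [set: K] H ->
  H t -> (t < u)%O -> H h -> (t < h)%O -> (forall r, H r -> (t < r)%O -> (u <= r)%O) -> rplus H t.
Proof.
move=> cK [_ oH] Ht tu Hh th gap; split=> //; right.
have [|m [m1 m2]] := compact_glb cK (A := [set r | H r /\ (t < r)%O]); first by exists h.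
have um : (u <= m)%O by apply: m2 => r [Hr tr]; exact: gap.
have tm : (t < m)%O by exact: lt_le_trans um.
exists m; split=> //; last by move=> r Hr tr; exact: m1.
apply: contrapT => nHm; have [//|lo [hi [lm hm hU]]] := oH m I.
have [r [Hr tr hr]] : exists r, [/\ H r, (t < r)%O & hi_ok [set: K] hi r].
  case: hi hm {hU} => [b [_ mb]|_]; last by exists h.
  apply: contrapT => nr; move: mb; rewrite ltNge m2// => r [Hr tr].
  by rewrite leNgt; apply/negP => rb; apply: nr; exists r.
have lr : lo_ok [set: K] lo r.
  case: lo lm {hU} => //= a [_ am]; split=> //; exact: lt_le_trans am (m1 r (conj Hr tr)).
by have [_] := hU r I lr hr; apply.
Qed.

End Closure.

(** * Closed intervals with their own order topology *)

Section Interval.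
Context {d : Order.disp_t} {K : orderType d}.
Variables (X : set K) (lo_end hi_end : K).
Hypothesis lo_hi : (lo_end <= hi_end)%O.
Hypothesis XP : forall x, X x <-> (lo_end <= x)%O /\ (x <= hi_end)%O.

Lemma oclosed_interval (H : set K) : oclosed X H -> oclosed [set: K] H.
Proof.
move=> [HX oH]; split=> // x _ [_ nHx].
have [Xx|nXx] := pselect (X x).
  have [//|lo [hi [lx hx h]]] := oH x Xx.
  exists lo, hi; split=> [||y _ ly hy].
  - by case: lo lx {h} => // a [].
  - by case: hi hx {h} => // a [].
  split=> // Hy; have Xy := HX _ Hy; have [] // := h y Xy.
    by case: lo lx ly {h} => // a [] ? ? [].
  by case: hi hx hy {h} => // a [] ? ? [].
have [xl|lx] := ltP x lo_end.
  exists None, (Some lo_end); split=> // y _ _ [_ yl]; split=> // /HX /XP[].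
  by rewrite leNgt yl.
have hx : (hi_end < x)%O by rewrite ltNge; apply/negP => xh; apply: nXx; apply/XP.
exists (Some hi_end), None; split=> // y _ [_ yl] _; split=> // /HX /XP[_].
by rewrite leNgt yl.
Qed.

Lemma oopen_interval (U : set K) : oopen [set: K] U -> oopen X U.
Proof.
move=> oU x Xx Ux; have [lo [hi [lx hx h]]] := oU x I Ux; have [ax xb] := (XP x).1 Xx.
(* A bound must lie in [X]. One that lies beyond an end of [X] excludes no point of [X] and is
   dropped. *)
exists (if lo is Some a then if (lo_end <= a)%O then Some a else None else None),
  (if hi is Some b then if (b <= hi_end)%O then Some b else None else None); split.
- case: lo lx {h} => //= a [_ ax']; case: ifPn => // la; split=> //; apply/XP; split=> //.
  exact: le_trans (ltW ax') xb.
- case: hi hx {h} => //= a [_ ax']; case: ifPn => // la; split=> //; apply/XP; split=> //.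
  exact: le_trans ax (ltW ax').
move=> y Xy ly hy; have [ay yb] := (XP y).1 Xy; apply: h => //.
- case: lo lx ly => //= a [_ ax']; case: ifPn => [_ []//|]; rewrite -ltNge => al _; split=> //.
  exact: lt_le_trans ay.
- case: hi hx hy => //= a [_ ax']; case: ifPn => [_ []//|]; rewrite -ltNge => al _; split=> //.
  exact: le_lt_trans al.
Qed.

Lemma oseparable_interval (H : set K) : oseparable X H -> oseparable [set: K] H.
Proof.
move=> [D [cD DH HD]]; exists D; split=> // x /HD [_ hx]; split=> // U oU Ux.
by apply: hx => //; exact: oopen_interval.
Qed.

(** Pushing forward along this map turns a family on [K] into a family on a fibre. *)
Definition retract (x : K) : K := Order.max lo_end (Order.min x hi_end).

Lemma retract_homo : {homo retract : x y / (x <= y)%O}.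
Proof. by move=> x y xy; rewrite /retract le_max2// le_min2. Qed.

Lemma retractX x : X (retract x).
Proof. by apply/XP; rewrite /retract le_max lexx ge_max lo_hi ge_min lexx orbT. Qed.

Lemma retract_id x : X x -> retract x = x.
Proof. by move=> /XP[ax xb]; rewrite /retract (min_idPl xb) (max_idPr ax). Qed.

Lemma retract_ge x : (hi_end <= x)%O -> retract x = hi_end.
Proof. by move=> hx; rewrite /retract (min_idPr hx) (max_idPr lo_hi). Qed.

Lemma ocont_retract : ocont [set: K] X retract.
Proof.
move=> B oB x _ Bx; have [lo [hi [lx hx h]]] := oB _ (retractX x) Bx.
exists lo, hi; split.
- case: lo lx {h} => //= a [/XP[la ah]]; rewrite /retract lt_max ltNge la /= lt_min.
  by move=> /andP[].
- case: hi hx {h} => //= a [/XP[la ah]]; rewrite /retract gt_max gt_min [(hi_end < a)%O]ltNge ah orbF.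
  by move=> /andP[].
move=> y _ ly hy; apply: h; first exact: retractX.
- case: lo lx ly => //= a [Xa]; have /XP[la ah] := Xa.
  rewrite /retract lt_max ltNge la /= lt_min => /andP[ax ab] [_ ay]; split=> //.
  by rewrite lt_max lt_min ay ab orbT.
- case: hi hx hy => //= a [Xa]; have /XP[la ah] := Xa.
  rewrite /retract gt_max => /andP[la' _] [_ ya]; split=> //.
  by rewrite gt_max la' gt_min ya.
Qed.

End Interval.

Lemma countable_l1_support (R : realType) (T : eqType) (Q : set T) (b : T -> R) (M : R) :
  (forall s, uniq s -> (forall t, t \in s -> Q t) -> \sum_(t <- s) `|b t| <= M) ->
  countable [set t | Q t /\ b t != 0].
Proof.
move=> bM; apply: (@countable_lt_inv R _ _ (fun t => `|b t|)).
  by move=> t [_]; rewrite normr_gt0.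
move=> e e0; apply: finite_set_countable; apply: contrapT => /infinite_injection [g [ginj ge]].
pose n := Num.bound (M / e).
have M0 : 0 <= M by have := bM [::]; rewrite big_nil; apply.
have := bM (map g (iota 0 n)); rewrite big_map => h.
have {h} : \sum_(j <- iota 0 n) `|b (g j)| <= M.
  apply: h => [|_ /mapP[j _ ->]]; first by rewrite map_inj_uniq ?iota_uniq.
  by have [[]] := ge j.
have : \sum_(j <- iota 0 n) e <= \sum_(j <- iota 0 n) `|b (g j)|.
  by apply: ler_sum => j _; have [] := ge j.
rewrite big_const_seq count_predT size_iota iter_addr_0.
have : M / e < n%:R by apply: archi_boundP; rewrite divr_ge0// ltW.
rewrite ltr_pdivrMr// mulr_natl => h1 h2 h3.
by have := le_lt_trans (le_trans h2 h3) h1; rewrite ltxx.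
Qed.

Lemma c0_or (R : realType) (I : Type) (a u v : I -> R) : c0 u -> c0 v ->
  (forall i, `|a i| <= `|u i| \/ `|a i| <= `|v i|) -> c0 a.
Proof.
move=> cu cv h e e0; apply: (@sub_finite_set _ _ ([set i | e <= `|u i|] `|` [set i | e <= `|v i|])).
  by move=> i /= ei; have [hi|hi] := h i; [left|right]; exact: le_trans ei hi.
by rewrite finite_setU; split; [exact: cu|exact: cv].
Qed.

(** * Fibres of a continuous increasing map *)

Section Fibres.
Context {d1 d2 : Order.disp_t} {K : orderType d1} {L : orderType d2}.
Variable phi : K -> L.
Hypothesis cK : ocompact [set: K].
Hypothesis cphi : ocont [set: K] [set: L] phi.
Hypothesis phi_homo : {homo phi : x y / (x <= y)%O}.

(** Let [m] be the supremum of the fibre. If [phi m] were above [phi x0], so would be [phi] on a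
    neighbourhood of [m], and this neighbourhood meets the fibre. *)
Lemma fibre_max x0 : exists m, phi m = phi x0 /\ forall x, phi x = phi x0 -> (x <= m)%O.
Proof.
have [|m [m1 m2]] := compact_lub cK (A := [set x | phi x = phi x0]); first by exists x0.
exists m; split=> //; apply/le_anti/andP; split; last by apply: phi_homo; exact: m1.
rewrite leNgt; apply/negP => lt.
have oB : oopen [set: L] [set z | (phi x0 < z)%O].
  by move=> z _ zt; exists (Some (phi x0)), None; split=> // w _ [_ ?] _.
have [lo [hi [lm hm h]]] := cphi oB I lt.
suff [x [xE lx]] : exists x, phi x = phi x0 /\ lo_ok [set: K] lo x.
  have hx : hi_ok [set: K] hi x.
    by case: hi hm {h} => // b [_ mb]; split=> //; apply: le_lt_trans mb; exact: m1.
  by have := h x I lx hx; rewrite /= xE ltxx.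
case: lo lm {h} => [a [_ am]|_]; last by exists x0.
apply: contrapT => nx; move: am; rewrite ltNge m2// => x xE.
by rewrite leNgt; apply/negP => ax; apply: nx; exists x.
Qed.

Lemma fibre_min x0 : exists m, phi m = phi x0 /\ forall x, phi x = phi x0 -> (m <= x)%O.
Proof.
have [|m [m1 m2]] := compact_glb cK (A := [set x | phi x = phi x0]); first by exists x0.
exists m; split=> //; apply/le_anti/andP; split; first by apply: phi_homo; exact: m1.
rewrite leNgt; apply/negP => lt.
have oB : oopen [set: L] [set z | (z < phi x0)%O].
  by move=> z _ zt; exists None, (Some (phi x0)); split=> // w _ _ [_ ?].
have [lo [hi [lm hm h]]] := cphi oB I lt.
suff [x [xE hx]] : exists x, phi x = phi x0 /\ hi_ok [set: K] hi x.
  have lx : lo_ok [set: K] lo x.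
    by case: lo lm {h} => // b [_ mb]; split=> //; apply: lt_le_trans mb _; exact: m1.
  by have := h x I lx hx; rewrite /= xE ltxx.
case: hi hm {h} => [a [_ am]|_]; last by exists x0.
apply: contrapT => nx; move: am; rewrite ltNge m2// => x xE.
by rewrite leNgt; apply/negP => ax; apply: nx; exists x.
Qed.

(** Choose in each such fibre a pair with distinct values. Fibres are ordered like their images, so
    finitely many pairs concatenate to one chain, and the sum of the jumps is at most the
    variation. *)
Lemma countable_nonconstant (R : realType) (F : K -> R) : bounded_var [set: K] F ->
  countable [set t | exists x y, [/\ phi x = t, phi y = t & F x != F y]].
Proof.
move=> [M bv]; set N := [set t | _].
have [[_ [z _]]|N0] := pselect (N !=set0); last first.
  by apply: (sub_countable _ (countable0 L)); apply: subset_card_le => t Nt; case: N0; exists t.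
have hp t : exists p : K * K, N t -> [/\ phi p.1 = t, phi p.2 = t, (p.1 < p.2)%O & F p.1 != F p.2].
  have [[x [y [xt yt Fxy]]]|nN] := pselect (N t); last first.
    by exists (z, z) => /nN.
  have [xy|yx|xy] := ltgtP x y; [by exists (x, y)| |by move: Fxy; rewrite xy eqxx].
  by exists (y, x); rewrite eq_sym.
have [p hN] := choice hp.
pose h t := F (p t).2 - F (p t).1.
have chain t s : sorted <%O (t :: s) -> (forall t', t' \in t :: s -> N t') -> exists c,
    sorted <%O ((p t).1 :: c) /\ \sum_(t' <- t :: s) `|h t'| <= chain_var F ((p t).1 :: c).
  elim: s t => [|t' s IH] t.
    move=> _ /(_ t (mem_head _ _)) Nt; have [_ _ lt _] := hN t Nt; exists [:: (p t).2].
    by rewrite /= lt big_cons !big_nil big_cons big_nil.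
  move=> ss sN; have /andP[tt' ss'] : (t < t')%O && path <%O t' s := ss.
  have [|c [sc hc]] := IH t' ss'; first by move=> u us; apply: sN; rewrite inE us orbT.
  have [pt1 pt2 lt _] := hN t (sN _ (mem_head _ _)).
  have [|pt1' _ _ _] := hN t' (sN _ _); first by rewrite !inE eqxx orbT.
  exists [:: (p t).2, (p t').1 & c]; split.
    apply/and3P; split=> //; rewrite ltNge; apply/negP => /phi_homo.
    by rewrite pt1' pt2 leNgt tt'.
  rewrite big_cons 2!chain_var_cons2 -/(h t).
  by have := normr_ge0 (F (p t').1 - F (p t).2); lra.
have M0 : 0 <= M by have := bv [::]; rewrite /=; apply.
have : countable [set t | N t /\ h t != 0].
  apply: (@countable_l1_support _ _ _ _ M) => s us sN.
  have -> : \sum_(t <- s) `|h t| = \sum_(t <- sorted_part s) `|h t|.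
    apply: perm_big; rewrite perm_sym uniq_perm//; last exact: mem_sorted_part.
    by rewrite sort_uniq undup_uniq.
  have sN' t : t \in sorted_part s -> N t by rewrite mem_sorted_part; exact: sN.
  have := sorted_part_lt s; case: (sorted_part s) sN' => [|t l] lN sl; first by rewrite big_nil.
  have [c [sc hc]] := chain t l sl lN; apply: le_trans hc _.
  exact: bv.
apply: sub_countable; apply: subset_card_le => t Nt; split=> //.
by have [_ _ _] := hN t Nt; rewrite subr_eq0 eq_sym.
Qed.

Section TopPoints.
Hypothesis cL : ocompact [set: L].
Variable top : L -> K.
Hypothesis topK : forall t, phi (top t) = t.
Hypothesis top_max : forall x, (x <= top (phi x))%O.

(* A point t of H which is not right-isolated in H is a limit from the right of D,
   so that [top t] is a limit from the right of [top @` D]. *)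
Lemma countable_lift (Q : set K) (P : K -> Prop) (H : set L) :
  oclosed [set: L] H -> oseparable [set: L] H ->
  (forall H' : set K, oclosed [set: K] H' -> oseparable [set: K] H' ->
     countable [set s | [/\ Q s, H' s, ~ rplus H' s & P s]]) ->
  countable [set t | [/\ Q (top t), H t, ~ rplus H t & P (top t)]].
Proof.
move=> clH [D [cD DH HD]] hQ.
pose D' := top @` D; pose H' := oclosure [set: K] D'.
have cD' : countable D' by apply: sub_countable cD; exact: card_image_le.
have cB := hQ H' (oclosed_oclosure _) (oseparable_oclosure cD').
pose B := [set s | [/\ Q s, H' s, ~ rplus H' s & P s]].
apply: (@sub_countable _ _ _ (phi @` B)); last first.
  by apply: sub_countable cB; exact: card_image_le.
apply: subset_card_le => t [Qt Ht nHt Pt]; exists (top t); last exact: topK.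
have [h [Hh th]] : exists h, H h /\ (t < h)%O.
  apply: contrapT => nh; apply: nHt; split=> //; left=> s Hs.
  by rewrite leNgt; apply/negP => ts; apply: nh; exists s.
(* A gap of [H] to the right of [t] would make [t] right-isolated in [H]. *)
have dense u : (t < u)%O -> exists r, [/\ H r, (t < r)%O & (r < u)%O].
  move=> tu; apply: contrapT => nr; apply: nHt; apply: (rplus_of_gap cL clH Ht tu Hh th).
  by move=> r Hr tr; rewrite leNgt; apply/negP => ru; apply: nr; exists r.
have near x : (top t < x)%O -> exists y, [/\ D' y, (top t < y)%O & (y < x)%O].
  move=> tx; have tpx : (t < phi x)%O.
    rewrite lt_neqAle -{2}(topK t) phi_homo ?(ltW tx)// andbT; apply/eqP => tE.
    by move: tx; rewrite ltNge tE top_max.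
  (* The interval (t, r) is a neighbourhood of r' in [H], so it contains a point of [D]; as r < phi
     x, the top of its fibre is below [x]. *)
  have [r [Hr tr rx]] := dense _ tpx; have [r' [Hr' tr' rr']] := dense _ tr.
  have [_ /(_ [set z | (t < z)%O /\ (z < r)%O])] := HD r' Hr'.
  have oI : oopen [set: L] [set z | (t < z)%O /\ (z < r)%O].
    by move=> z _ [tz zr]; exists (Some t), (Some r); split=> // w _ [_ ?] [_ ?].
  move=> /(_ oI) [//|dd [Ddd [tdd ddr]]]; exists (top dd); split; first by exists dd.
    by rewrite ltNge; apply/negP => /phi_homo; rewrite !topK leNgt tdd.
  by rewrite ltNge; apply/negP => /phi_homo; rewrite !topK leNgt (lt_trans ddr rx).
have th' : (top t < top h)%O by rewrite ltNge; apply/negP => /phi_homo; rewrite !topK leNgt th.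
split=> //.
- split=> // U oU Ut; have [lo [hi [lx hx hU]]] := oU _ I Ut.
  have [x tx xhi] : exists2 x, (top t < x)%O & forall y, (y < x)%O -> hi_ok [set: K] hi y.
    case: hi hx {hU} => [b [_ tb]|_]; last by exists (top h).
    by exists b.
  have [y [Dy ty yx]] := near x tx; exists y; split=> //; apply: hU => //; last exact: xhi.
  by case: lo lx => // a [_ ?]; split=> //; exact: lt_trans ty.
- move=> [_ [hmax|[s [H's ts hs]]]].
    have [y [Dy ty _]] := near _ th'.
    by have := hmax y (subset_oclosure Dy); rewrite leNgt ty.
  have [y [Dy ty ys]] := near _ ts.
  by have := hs y (subset_oclosure Dy) ty; rewrite leNgt ys.
Qed.

End TopPoints.
End Fibres.

(* The push-forward of F_i under the retraction of K onto X = [lo_end, hi_end] differs from F_i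
   only at [hi_end], a point which is right-isolated in each H contained in X. *)
Lemma fibre_c0l1 (R : realType) (d : Order.disp_t) (K : orderType d) (X : set K)
  (lo_end hi_end m : K) (I : Type) (F : I -> K -> R) (Q : set K) :
  (lo_end <= hi_end)%O -> (forall x, X x <-> (lo_end <= x)%O /\ (x <= hi_end)%O) ->
  (forall y : K, (y <= m)%O) -> sep_determined R X ->
  (forall i, NBV [set: K] (F i)) -> weakstar_null [set: K] F ->
  (forall H : set K, oclosed [set: K] H -> oseparable [set: K] H ->
     countable [set t | [/\ Q t, H t, ~ rplus H t & ~ c0 (fun i => F i t)]]) ->
  exists a b : I -> K -> R, [/\ forall i s, X s -> Q s -> s != hi_end -> F i s = a i s + b i s,
    forall s, X s -> Q s -> c0 (a^~ s) & 
    forall i, countable [set s | [/\ X s, Q s & b i s != 0]]].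
Proof.
move=> lh XP mm sdX NBVF wF hQ.
(* Everything above [hi_end] is retracted to it, so the largest point of its fibre is the maximum
   [m] of [K]. *)
pose beta s := if s == hi_end then m else s.
pose r := retract lo_end hi_end.
have rX x : X (r x) by exact: retractX.
have rK s : X s -> r (beta s) = s.
  move=> Xs; rewrite /beta; case: eqP => [->|_]; first exact: retract_ge.
  exact: (retract_id XP).
have rmax x : (x <= beta (r x))%O.
  rewrite /beta; case: ifPn => // rx; have [xh|hx] := leP x hi_end.
    by rewrite /r /retract (min_idPl xh) le_max lexx orbT.
  by move: rx; rewrite /r retract_ge ?eqxx// ltW.
have rh : {homo r : x y / (x <= y)%O} by exact: retract_homo.
have [||||a [b [Fab a0 [M bM]]]] := sdX I (fun i => F i \o beta) _ _ (X `&` Q).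
- by move=> i; exact: (NBV_pushforward rh rX rK rmax).
- exact: (weakstar_null_pushforward rh rX rK rmax (ocont_retract lh XP) wF).
- by move=> s [].
- move=> H clH sH.
  have := hQ H (oclosed_interval XP clH) (oseparable_interval XP sH).
  apply: sub_countable; apply: subset_card_le => s [[Xs Qs] Hs nrs nc]; split=> //.
  move: nc; rewrite /= /beta; case: eqP => // sh _.
  (* Here the point is [hi_end], the maximum of [H]. *)
  by case: nrs; split=> //; left=> u Hu; rewrite sh; have [_] := (XP u).1 (clH.1 _ Hu).
exists a, b; split.
- by move=> i s Xs Qs sh; rewrite -Fab//= /beta (negbTE sh).
- by move=> s Xs Qs; exact: a0.
move=> i; apply: sub_countable (countable_l1_support (bM i)); apply: subset_card_le.
by move=> s [].
Qed.

(** * Assembling the decompositions over [L] and over the fibres *)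

Unset Implicit Arguments.

Theorem theorem3p10 (R : realType) (d1 d2 : Order.disp_t)
  (K : orderType d1) (L : orderType d2) (phi : K -> L) :
  ocompact [set: K] -> ocompact [set: L] ->
  ocont [set: K] [set: L] phi ->
  {homo phi : x y / (x <= y)%O} ->
  (forall t : L, exists x : K, phi x = t) ->
  sep_determined R [set: L] ->
  (forall t : L, sep_determined R (phi @^-1` [set t])) ->
  sep_determined R [set: K].
Proof.
move=> cK cL cphi hphi surj sdL sdF I F NBVF wF Q _ hQ.
(* Continuity is put after the existential so that choice gives one operator [T] on all functions; 0
   is a dummy value. *)
have exT f : exists v : I -> R, ocont [set: K] [set: R] f ->
    (forall i, stieltjes_int [set: K] (F i) f (v i)) /\ c0 v.
  have [cf|ncf] := pselect (ocont [set: K] [set: R] f); last by exists (fun=> 0).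
  by have [v hv] := wF f cf; exists v.
have [T TP] := choice exT.
have exmax t : exists m, phi m = t /\ forall x, phi x = t -> (x <= m)%O.
  by have [x <-] := surj t; exact: fibre_max.
have exmin t : exists m, phi m = t /\ forall x, phi x = t -> (m <= x)%O.
  by have [x <-] := surj t; exact: fibre_min.
have [top htop] := choice exmax; have [bot hbot] := choice exmin.
have topK t : phi (top t) = t by case: (htop t).
have botK t : phi (bot t) = t by case: (hbot t).
have top_max x : (x <= top (phi x))%O by case: (htop (phi x)) => _; exact.
have bot_min x : (bot (phi x) <= x)%O by case: (hbot (phi x)) => _; exact.
have bot_top t : (bot t <= top t)%O by case: (hbot t) => _; exact.
pose Q' := [set t | Q (top t)].
have [aL [bL [FL aL0 [ML bLM]]]] : type_c0l1 Q' (fun i => F i \o top).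
  apply: (sdL _ _ _ _ Q') => //.
  - by move=> i; apply: (NBV_pushforward (psi := phi)).
  - exact: (weakstar_null_pushforward (psi := phi)).
  move=> H clH sH.
  exact: (countable_lift hphi cL topK top_max (P := fun s => ~ c0 (fun i => F i s)) clH sH hQ).
have exab t : exists ab : (I -> K -> R) * (I -> K -> R),
    [/\ forall i s, phi s = t -> Q s -> s != top t -> F i s = ab.1 i s + ab.2 i s,
    forall s, phi s = t -> Q s -> c0 (ab.1^~ s) &
    forall i, countable [set s | [/\ phi s = t, Q s & ab.2 i s != 0]]].
  have [m mm] := compact_max cK (top t).
  have XP x : (phi @^-1` [set t]) x <-> (bot t <= x)%O /\ (x <= top t)%O.
    split=> [/= <-//|[tx xt]] /=; apply/le_anti.
    by rewrite -{2}(botK t) -{1}(topK t) !hphi.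
  have [a [b h]] := fibre_c0l1 (bot_top t) XP mm (sdF t) NBVF wF hQ.
  by exists (a, b).
have [ab hab] := choice exab.
pose flat i t := forall x y, phi x = t -> phi y = t -> F i x = F i y.
(* The value 0 where F_i is constant on the fibre confines [b i], apart from the top points, to
   countably many fibres. *)
pose b i s := let t := phi s in if s == top t then bL i t else
  if `[< flat i t >] then 0 else (ab t).2 i s.
apply: (type_c0l1_of_countable_support NBVF TP _ (a := fun i s => F i s - b i s) (b := b)).
- by move=> x; exact: compact_max cK x.
- by move=> i s _; rewrite subrK.
- move=> s Qs; rewrite /b; case: eqP => [sE|/eqP st].
    have Q's : Q' (phi s) by rewrite /Q' /= -sE.
    rewrite (_ : (fun i => _) = (fun i => aL i (phi s))); first exact: aL0.
    by apply/funext => i; rewrite {1}sE -[F i _]/((F i \o top) _) FL// addrK.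
  (* A cut from the bottom to the top of the fibre has integral F_i(s) if F_i is constant on the
     fibre; for the other i the fibre decomposition applies. So one of two c_0 families dominates at
     each i. *)
  have [|f cf] := @exists_cut R _ _ (bot (phi s)) (top (phi s)).
    by apply: (le_lt_trans (bot_min s)); rewrite lt_neqAle st top_max.
  have [cf' _ _ _] := cf; have [Ti c0T] := TP _ cf'.
  have [Fab a0 _] := hab (phi s).
  apply: (c0_or c0T (a0 s erefl Qs)) => i; case: asboolP => [fl|nfl].
    left; rewrite subr0 (_ : T f i = F i s)//.
    apply/eqP; rewrite -subr_eq0 -normr_le0 (fl s (bot (phi s)))//.
    apply: integral_cut_near (Ti i) cf _ => u bu ut.
    rewrite (fl u (bot (phi s))) ?subrr ?normr0//.
    by apply/le_anti; rewrite -{2}(botK (phi s)) -{1}(topK (phi s)) !hphi// ltW.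
  by right; rewrite (Fab i s)// addrK.
move=> i.
pose N := [set t | exists x y, [/\ phi x = t, phi y = t & F i x != F i y]].
pose A t := [set s | [/\ phi s = t, Q s & (ab t).2 i s != 0]].
(* The first part is countable since [bL i] is summable, the second since countably many fibres are
   nonconstant for F_i, each with a countable support. *)
pose B := top @` [set t | Q' t /\ bL i t != 0] `|` \bigcup_(t in N) A t.
apply: (@sub_countable _ _ _ B).
  apply: subset_card_le => s [Qs]; rewrite /b; case: (s =P top (phi s)) => [sE bn0|_].
    by left; exists (phi s) => //; split=> //; rewrite /Q' /= -sE.
  case: ifPn => [_|/asboolPn nfl]; first by rewrite eqxx.
  have Ns : N (phi s).
    apply: contrapT => nN; apply: nfl => x y xs ys; apply/eqP; apply: contrapT => /negP Fxy.
    by apply: nN; exists x, y.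
  by move=> h; right; exists (phi s).
rewrite /B -bigcup2E; apply: bigcup_countable => // -[|[|k]] _ //=.
  have := countable_l1_support (bLM i); apply: sub_countable; exact: card_image_le.
apply: bigcup_countable; first by apply: countable_nonconstant; case: (NBVF i).
by move=> t _; have [_ _] := hab t; apply.
Qed.
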